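(* Let $n\geq 2$, $s\in[-n,0]$ and \[ \nu_{0}= \frac{(3-2n)s+1-2n+\sqrt{(1-s)[(4n-5)s+4n^2-4n+1]} }{2(n-1)^2}. \] If $\nu\in\mathbb{R}\setminus[-s/n,\nu_0]$, then there is no $\underline{\xi}\in\mathbb{R}^n$ (with $1,\xi_1,\ldots,\xi_n$ linearly independent over $\mathbb{Q}$) such that $\underline{\varphi}_{1}=s$, $\overline{\varphi}_{n+1}=\nu$, and equality holds in \[ n\overline{\varphi}_{n+1} +\underline{\varphi}_{1} \geq -\overline{\varphi}_{1}\cdot \left(\frac{n+1}{n-1}+\overline{\varphi}_{n+1}+\frac{2}{n-1}\underline{\varphi}_{1} \right). \]
   Context: For $\underline{\xi}=(\xi_1,\ldots,\xi_n)\in\mathbb{R}^n$ with $\{1,\xi_1,\ldots,\xi_n\}$ linearly independent over $\mathbb{Q}$ and $q>0$, let $K(q)\subseteq\mathbb{R}^{n+1}$ be the box $|z_0|\leq e^{nq}$, $\max_{1\le i\le n}|z_i|\leq e^{-q}$, and $\Lambda_{\underline{\xi}}=\{(x,\xi_1x-y_1,\ldots,\xi_nx-y_n): x,y_i\in\mathbb{Z}\}$. Let $\lambda_1(q)\le\cdots\le\lambda_{n+1}(q)$ be the successive minima of $K(q)$ w.r.t. $\Lambda_{\underline{\xi}}$, $\varphi_j(q)=\log\lambda_j(q)/q$, $\underline{\varphi}_j=\liminf_{q\to\infty}\varphi_j(q)$, $\overline{\varphi}_j=\limsup_{q\to\infty}\varphi_j(q)$. *)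

(* Defs.v *)
From HB Require Import structures.
From mathcomp Require Import all_boot all_order all_algebra.
From mathcomp Require Import all_classical all_reals all_analysis.
Set Implicit Arguments. Unset Strict Implicit. Unset Printing Implicit Defensive.
Import Order.TTheory GRing.Theory Num.Theory.
Import numFieldNormedType.Exports.
Local Open Scope classical_set_scope.
Local Open Scope ring_scope.

Section Defs.
Variables (R : realType) (n : nat).

Definition Qlin_indep (xi : 'I_n -> R) : Prop :=
  forall (c0 : rat) (c : 'I_n -> rat),
    ratr c0 + \sum_(i < n) ratr (c i) * xi i = 0 ->
    c0 = 0 /\ forall i, c i = 0.

Definition in_lattice (xi : 'I_n -> R) (v : 'rV[R]_n.+1) : Prop :=
  exists (x : int) (y : 'I_n -> int),
    v ord0 ord0 = x%:~R /\
    forall i : 'I_n, v ord0 (lift ord0 i) = xi i * x%:~R - (y i)%:~R.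

Definition in_scaled_box (q lam : R) (v : 'rV[R]_n.+1) : Prop :=
  `|v ord0 ord0| <= lam * expR (n%:R * q) /\
  forall i : 'I_n, `|v ord0 (lift ord0 i)| <= lam * expR (- q).

(* j-th successive minimum (j = 1, ..., n+1) of K(q) w.r.t. Lambda_xi:
   inf of lam > 0 such that lam K(q) contains j linearly independent
   points of Lambda_xi (the rows of a rank-j matrix). *)
Definition succ_min (xi : 'I_n -> R) (q : R) (j : nat) : R :=
  inf [set lam : R | 0 < lam /\
        exists M : 'M[R]_(j, n.+1), \rank M = j /\
          forall k : 'I_j, in_lattice xi (row k M) /\ in_scaled_box q lam (row k M)].

Definition phi (xi : 'I_n -> R) (j : nat) (q : R) : R :=
  ln (succ_min xi q j) / q.

Definition phi_liminf (xi : 'I_n -> R) (j : nat) : \bar R :=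
  limf_einf (fun q : R => (phi xi j q)%:E) (pinfty_nbhs R).
Definition phi_limsup (xi : 'I_n -> R) (j : nat) : \bar R :=
  limf_esup (fun q : R => (phi xi j q)%:E) (pinfty_nbhs R).

End Defs.

(* Main.v *)
Require Import Defs.
From mathcomp Require Import all_boot all_order all_algebra.
From mathcomp Require Import all_classical all_reals all_analysis.
From mathcomp Require Import fingroup perm ring lra.
Import Order.TTheory GRing.Theory Num.Theory.
Import numFieldNormedType.Exports.
Set Implicit Arguments. Unset Strict Implicit. Unset Printing Implicit Defensive.
Local Open Scope classical_set_scope.
Local Open Scope ring_scope.

(* Write s, nu for the given limits, t for the limsup of phi_1, and
   w = (1 - t) / (n + t) for the uniform exponent of simultaneous approximation.
   Every estimate comes from the fact that n + 1 independent lattice points have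
   determinant at least 1. With one short point z and a basis from the last
   minimum this gives n nu + s >= 0. For the other bound, equality amounts to
   w (n + s) = 1 + s + (n - 1) nu, and nu <= nu0 to
   (1 + s + (n - 1) nu)^2 <= (1 - nu) (1 - s). Let z be a point of size
   e^((n + s) q) realising s, and reduce a basis from the last minimum at q
   modulo z. If x is the smallest point approximating almost as well as
   e^(- w (n + s) q), and x' the approximation preceding x, then the determinant
   of x, x' and reduced basis vectors forces |x_0| <= e^((1 - nu) q / w), while
   the finite ordinary exponent forces |x_0| >= e^(w (n + s)^2 q / (1 - s)).
   This needs w < 1, that is nu < 1; when w = 1 the minimal points would
   eventually lie in a plane, contradicting the linear independence. *)

(** * Head and tail of a vector, and determinant bounds in terms of them *)

Section Heights.
Variables (R : realType) (n : nat).
Implicit Types (v w : 'rV[R]_n.+1) (s : seq 'rV[R]_n.+1).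

Definition hd v : R := `|v ord0 ord0|.
Definition tl v : R := \big[Num.max/0]_(i < n) `|v ord0 (lift ord0 i)|.

Lemma hd_ge0 v : 0 <= hd v. Proof. exact: normr_ge0. Qed.
Hint Resolve hd_ge0 : core.

Lemma tl_ge0 v : 0 <= tl v. Proof. exact: bigmax_ge_id. Qed.
Hint Resolve tl_ge0 : core.

Lemma coord_le_tl v i : `|v ord0 (lift ord0 i)| <= tl v.
Proof. exact: le_bigmax. Qed.

Lemma tl_leP v y : 0 <= y ->
  (forall i, `|v ord0 (lift ord0 i)| <= y) -> tl v <= y.
Proof. by move=> y0 H; apply/bigmax_leP; split. Qed.

Lemma coordP v j : j = ord0 \/ exists i, j = lift ord0 i :> 'I_n.+1.
Proof. by case: (unliftP ord0 j) => [i ->|->]; [right; exists i|left]. Qed.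

Lemma hdZ c v : hd (c *: v) = `|c| * hd v.
Proof. by rewrite /hd mxE normrM. Qed.

Lemma tlZ c v : tl (c *: v) <= `|c| * tl v.
Proof.
apply: tl_leP => [|i]; first by rewrite mulr_ge0.
by rewrite mxE normrM ler_wpM2l// coord_le_tl.
Qed.

Lemma tlB v w : tl (v - w) <= tl v + tl w.
Proof.
apply: tl_leP => [|i]; first by rewrite addr_ge0.
by rewrite !mxE (le_trans (ler_normB _ _))// lerD// coord_le_tl.
Qed.

Fixpoint tlprod s : R := if s is v :: s' then tl v * tlprod s' else 1.

(** The sum, over the members of the sequence, of the head of that member times the tails of all the
    others. *)
Fixpoint detbound s : R :=
  if s is v :: s' then hd v * tlprod s' + tl v * detbound s' else 0.

Lemma tlprod_ge0 s : 0 <= tlprod s.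
Proof. by elim: s => //= v s ih; rewrite mulr_ge0. Qed.
Hint Resolve tlprod_ge0 : core.

Lemma detbound_ge0 s : 0 <= detbound s.
Proof. by elim: s => //= v s ih; rewrite addr_ge0// mulr_ge0. Qed.
Hint Resolve detbound_ge0 : core.

Lemma tlprodE s : tlprod s = \prod_(k < size s) tl s`_k.
Proof. by elim: s => [|v s ih] /=; rewrite ?big_ord0// big_ord_recl/= ih. Qed.

Lemma le_detbound s (i : 'I_(size s)) :
  hd s`_i * \prod_(k < size s | k != i) tl s`_k <= detbound s.
Proof.
elim: s i => [[]//|v s ih] /= i.
rewrite big_mkcond big_ord_recl/=.
case: (unliftP ord0 i) => [j ->|->].
- rewrite neq_lift lift0 [nth _ _ _]/=.
  rewrite (eq_bigr (fun k => if k != j then tl s`_k else 1)).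
    by rewrite -big_mkcond mulrCA -[leLHS]add0r lerD// ?mulr_ge0// ler_wpM2l// ih.
  by move=> k _; rewrite (inj_eq lift_inj).
- rewrite eqxx mul1r -[leLHS]addr0 lerD ?mulr_ge0// ler_wpM2l//.
  by rewrite tlprodE le_eqVlt; apply/orP; left; apply/eqP/eq_bigr.
Qed.

(** Each Leibniz term takes its entry of column [ord0] from the single row [i0] and tail entries
    from all other rows, so it is at most one summand of [detbound]. There are (n+1)! terms. *)
Lemma det_le_detbound s : size s = n.+1 ->
  `|\det (\matrix_(i < n.+1) s`_i)| <= (n.+1)`!%:R * detbound s.
Proof.
move=> sz; rewrite /determinant; apply: le_trans (ler_norm_sum _ _ _) _.
rewrite -card_Sn mulr_natl -sumr_const; apply: ler_sum => sg _.
rewrite normrM normrX normrN1 expr1n mul1r normr_prod.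
pose i0 : 'I_n.+1 := (sg^-1)%g ord0.
have s0 : sg i0 = ord0 by rewrite /i0 permKV.
move: (@le_detbound s); rewrite sz => /(_ i0); apply: le_trans.
rewrite (bigD1 i0)//= ler_pM//; first exact: prodr_ge0.
  by rewrite !mxE s0.
apply: ler_prod => k ki; rewrite normr_ge0 /=.
case: (unliftP ord0 (sg k)) => [j e|e].
  by rewrite mxE e coord_le_tl.
by move: ki; rewrite -(inj_eq (@perm_inj _ sg)) e s0 eqxx.
Qed.

Lemma tlprod_cat s1 s2 (y : R) : (forall v, v \in s1 -> tl v <= y) ->
  tlprod (s1 ++ s2) <= y ^+ size s1 * tlprod s2.
Proof.
elim: s1 => [|v s ih] /= H; first by rewrite expr0 mul1r.
rewrite exprS -mulrA ler_pM ?H ?mem_head// ih// => u us.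
by rewrite H// inE us orbT.
Qed.

(** The single head comes either from [s1], in [size s1] ways, or from [s2]. The predecessor in the
    exponent leaves out the vector that contributes the head. *)
Lemma detbound_cat s1 s2 (x y : R) :
  (forall v, v \in s1 -> hd v <= x) -> (forall v, v \in s1 -> tl v <= y) ->
  detbound (s1 ++ s2) <=
    (size s1)%:R * x * y ^+ (size s1).-1 * tlprod s2 + y ^+ size s1 * detbound s2.
Proof.
elim: s1 => [|v s ih] hx hy; first by rewrite !mul0r add0r expr0 mul1r.
have xv : hd v <= x by rewrite hx ?mem_head.
have yv : tl v <= y by rewrite hy ?mem_head.
have hx' u : u \in s -> hd u <= x by move=> us; rewrite hx// inE us orbT.
have hy' u : u \in s -> tl u <= y by move=> us; rewrite hy// inE us orbT.
have x0 : 0 <= x by apply: le_trans xv.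
have y0 : 0 <= y by apply: le_trans yv.
have {}ih := ih hx' hy'.
rewrite [detbound _]/= [size _]/= [_.-1]/=.
have h1 : hd v * tlprod (s ++ s2) <= x * (y ^+ size s * tlprod s2).
  by rewrite ler_pM// tlprod_cat.
have h2 : tl v * detbound (s ++ s2) <= y * ((size s)%:R * x * y ^+ (size s).-1 *
    tlprod s2 + y ^+ size s * detbound s2) by rewrite ler_pM.
apply: le_trans (lerD h1 h2) _.
rewrite le_eqVlt; apply/orP; left; apply/eqP.
rewrite -[(size s).+1]addn1 natrD exprD expr1.
case: (size s) => [|k] /=; first by rewrite expr0; ring.
by rewrite exprS; ring.
Qed.

End Heights.
#[global] Hint Resolve hd_ge0 tl_ge0 tlprod_ge0 detbound_ge0 : core.

(** * Integer coordinates on the lattice and the lower bound 1 for determinants *)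

Section Lattice.
Variables (R : realType) (n : nat) (xi : 'I_n -> R).
Implicit Types (v w : 'rV[R]_n.+1) (s : seq 'rV[R]_n.+1).

(** The signs are chosen so that the integer coordinates of a lattice point are exactly the x and y
    of [in_lattice]. *)
Definition lattice_basis : 'M[R]_n.+1 :=
  \matrix_(i, j) if i == ord0 then oapp xi 1 (unlift ord0 j) else - (i == j)%:R.

Lemma lattice_basis_lift (u : 'rV[R]_n.+1) :
  (u *m lattice_basis) ord0 ord0 = u ord0 ord0 /\
  forall i, (u *m lattice_basis) ord0 (lift ord0 i)
    = xi i * u ord0 ord0 - u ord0 (lift ord0 i).
Proof.
split=> [|i]; rewrite mxE big_ord_recl !mxE eqxx.
  rewrite unlift_none mulr1 big1 ?addr0// => j _.
  by rewrite !mxE /= oppr0 mulr0.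
rewrite liftK /= mulrC; congr (_ + _).
rewrite (bigD1 i)//= !mxE eqxx mulrN1 big1 ?addr0// => j ji.
by rewrite !mxE (inj_eq lift_inj) (negbTE ji) oppr0 mulr0.
Qed.

Lemma in_latticeP v : in_lattice xi v <->
  exists c : 'rV[int]_n.+1, v = map_mx intr c *m lattice_basis.
Proof.
split=> [[x [y [v0 vi]]]|[c ->]].
  exists (\row_j oapp y x (unlift ord0 j)); apply/rowP => j.
  have [h0 hi] := lattice_basis_lift (map_mx intr (\row_j oapp y x (unlift ord0 j))).
  have [->|[i ->]] := coordP v j.
    by rewrite h0 !mxE unlift_none v0.
  by rewrite hi !mxE unlift_none liftK vi.
have [h0 hi] := lattice_basis_lift (map_mx intr c).
exists (c ord0 ord0), (fun i => c ord0 (lift ord0 i)); split.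
  by rewrite h0 mxE.
by move=> i; rewrite hi !mxE.
Qed.

Lemma det_lattice_basis : `|\det lattice_basis| = 1.
Proof.
rewrite -det_tr det_trig; last first.
  apply/is_trig_mxP => i j ij; rewrite !mxE.
  have -> : (j == ord0) = false by apply/negbTE/eqP => j0; rewrite j0 in ij.
  by rewrite (gtn_eqF ij : j == i = false) oppr0.
rewrite normr_prod big1// => i _; rewrite !mxE.
by case: eqP => [->|_]; rewrite ?unlift_none ?normr1// eqxx normrN1.
Qed.

Lemma lattice_basis_unit : lattice_basis \in unitmx.
Proof. by rewrite unitmxE unitfE -normr_eq0 det_lattice_basis oner_eq0. Qed.

Lemma in_lattice_basis i : in_lattice xi (row i lattice_basis).
Proof.
apply/in_latticeP; exists (delta_mx 0 i).
by rewrite rowE; congr (_ *m _); apply/rowP => j; rewrite !mxE; case: (_ && _).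
Qed.

Lemma in_latticeB v w : in_lattice xi v -> in_lattice xi w -> in_lattice xi (v - w).
Proof.
move=> /in_latticeP[c ->] /in_latticeP[d ->]; apply/in_latticeP; exists (c - d).
by rewrite map_mxB mulmxBl.
Qed.

Lemma in_latticeZ (k : int) v : in_lattice xi v -> in_lattice xi (k%:~R *: v).
Proof.
move=> /in_latticeP[c ->]; apply/in_latticeP; exists (k *: c).
by rewrite map_mxZ scalemxAl.
Qed.

(** The rows have integer coordinates with respect to [lattice_basis], whose determinant is 1 up to
    sign. Hence the determinant is, up to sign, a nonzero integer. *)
Lemma lattice_det_ge1 (A : 'M[R]_n.+1) :
  (forall i, in_lattice xi (row i A)) -> \det A != 0 -> 1 <= `|\det A|.
Proof.
move=> /(_ _)/in_latticeP/cid-/all_sig[c cE].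
have -> : A = map_mx intr (\matrix_i c i) *m lattice_basis.
  by apply/row_matrixP => i; rewrite row_mul -map_row rowK cE.
rewrite det_mulmx normrM det_lattice_basis mulr1 det_map_mx.
rewrite mulf_eq0 negb_or => /andP[]; rewrite intr_eq0 => d0 _.
by rewrite -intr_norm -[1]/(1%:~R) ler_int -gtz0_ge1 normr_gt0.
Qed.

Lemma hd_nat v : in_lattice xi v -> exists k : nat, hd v = k%:R.
Proof.
move=> [x [_ [v0 _]]]; exists `|x|%N.
by rewrite /hd v0 -intr_norm -abszE.
Qed.

Lemma lattice_tl_ge1 v : in_lattice xi v -> v != 0 -> hd v = 0 -> 1 <= tl v.
Proof.
move=> [x [y [v0 vi]]] vn0 h0.
have x0 : x = 0.
  by move: h0 => /eqP; rewrite /hd v0 normr_eq0 intr_eq0 => /eqP.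
have /existsP[i yi] : [exists i, y i != 0].
  apply: contraNT vn0; rewrite negb_exists => /forallP y0.
  apply/eqP/rowP => j; rewrite mxE; have [->|[i ->]] := coordP v j.
    by rewrite v0 x0.
  by rewrite vi x0 mulr0 sub0r; move/(_ i): y0; rewrite negbK => /eqP->; rewrite oppr0.
apply: le_trans (coord_le_tl v i); rewrite vi x0 mulr0 sub0r normrN.
by rewrite -intr_norm -[1]/(1%:~R) ler_int -gtz0_ge1 normr_gt0.
Qed.

Lemma hd_ge1 v : in_lattice xi v -> v != 0 -> tl v < 1 -> 1 <= hd v.
Proof.
move=> lv v0 tv; have [k hk] := hd_nat lv.
case: k hk => [hk|k ->]; last by rewrite ler1n.
by move: (lattice_tl_ge1 lv v0 hk); rewrite leNgt tv.
Qed.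

Lemma free_det_neq0 s : free s -> size s = n.+1 -> \det (\matrix_(i < n.+1) s`_i) != 0.
Proof.
move=> fs sz; apply/det0P => -[u u0 uA].
have szT : size s == n.+1 by rewrite sz.
have /freeP H : free (Tuple szT) by [].
case/eqP: u0; apply/rowP => i; rewrite mxE; apply: (H (fun i => u ord0 i)) => //.
rewrite -[RHS]uA mulmx_sum_row; apply: eq_bigr => j _; by rewrite rowK.
Qed.

Lemma span_row_full (A : 'M[R]_n.+1) : A \in unitmx ->
  forall v, v \in << [seq row i A | i : 'I_n.+1] >>%VS.
Proof.
move=> uA v; rewrite -[v](mulmxKV uA) mulmx_sum_row; apply: memv_suml => i _.
by apply/memvZ/memv_span/map_f; rewrite mem_enum.
Qed.

(** Steinitz exchange, by induction on the number of missing vectors: while [s] is too short, some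
    member of [W] lies outside its span. *)
Lemma free_extend s W : free s -> (forall v, v \in << W >>%VS) ->
  exists2 r, {subset r <= W} & free (r ++ s) /\ size (r ++ s) = n.+1.
Proof.
move=> fs fW.
have dimE : \dim {: 'rV[R]_n.+1} = n.+1 by rewrite dimvf; exact: mul1n.
have le_size (t : seq 'rV[R]_n.+1) : free t -> (size t <= n.+1)%N.
  by move=> /eqP <-; rewrite -[leqRHS]dimE; exact/dimvS/subvf.
elim: (n.+1 - size s)%N {-2}s (erefl (n.+1 - size s)%N) fs => [|m ih] {}s e fs.
  exists [::]; rewrite //=; split=> //; apply/eqP; rewrite eqn_leq le_size//=.
  by rewrite -subn_eq0 e.
have [w wW ws] : exists2 w, w \in W & w \notin << s >>%VS.
  apply/hasP; rewrite has_predC; apply/negP => /allP /= H.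
  have /dimvS : (fullv <= << s >>)%VS.
    apply: subv_trans (_ : << W >> <= _)%VS; last exact/span_subvP.
    by apply/subvP => v _.
  rewrite dimE => h; have : (n.+1 <= size s)%N by rewrite (leq_trans h) ?dim_span.
  by rewrite -subn_eq0 e.
have fws : free (w :: s) by rewrite free_cons ws.
have [||r rW [fr sr]] := ih (w :: s) => //=.
  by rewrite subnS e.
exists (rcons r w); last by rewrite cat_rcons.
by move=> u; rewrite mem_rcons inE => /predU1P[->|/rW].
Qed.

(* Completing the independent lattice points [s] by vectors of the spanning
   family [W] gives a determinant which is a nonzero integer up to sign. *)
Lemma lattice_minkowski s W (x y : R) : free s -> (forall v, v \in s -> in_lattice xi v) ->
  (forall v, v \in << W >>%VS) ->
  (forall w, w \in W -> [/\ in_lattice xi w, hd w <= x & tl w <= y]) ->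
  1 <= (n.+1)`!%:R * ((n.+1 - size s)%:R * x * y ^+ (n - size s) * tlprod s
                      + y ^+ (n.+1 - size s) * detbound s).
Proof.
move=> fs ls fW HW; have [r rW [fr sr]] := free_extend fs fW.
have lr v : v \in r ++ s -> in_lattice xi v.
  by rewrite mem_cat => /orP[/rW/HW[]|/ls].
apply: le_trans (@lattice_det_ge1 (\matrix_(i < n.+1) (r ++ s)`_i) _ _) _.
- by move=> i; rewrite rowK; apply/lr/mem_nth; rewrite sr.
- exact: free_det_neq0.
apply: le_trans (det_le_detbound sr) _; rewrite ler_wpM2l//.
have sz : (size r + size s)%N = n.+1 by rewrite -size_cat.
have e : (n.+1 - size s = size r)%N by rewrite -[X in (X - _)%N]sz addnK.
rewrite e (_ : n - size s = (size r).-1)%N; last by rewrite -e subSKn.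
by apply: detbound_cat => v /rW/HW[].
Qed.

End Lattice.

(** * Upper and lower limits at infinity in epsilon form *)

Section Limsup.
Variables (R : realType) (f : R -> R) (l : R).

Lemma limsup_pinfty_lt m :
  limf_esup (fun q => (f q)%:E) (pinfty_nbhs R) = l%:E -> l < m ->
  exists2 q0, 0 < q0 & forall q, q0 <= q -> f q < m.
Proof.
rewrite limf_esupE => fl lm.
have /ereal_inf_lt[_ [V [M [_ MV]] <-] Vm] :
    (ereal_inf [set ereal_sup ((fun q => (f q)%:E) @` V) | V in pinfty_nbhs R] < m%:E)%E.
  by rewrite fl lte_fin.
exists (Num.max 1 (M + 1)); first by rewrite lt_max ltr01.
move=> q; rewrite ge_max => /andP[_ Mq].
rewrite -lte_fin; apply: le_lt_trans Vm; apply: ereal_sup_ubound.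
by exists q => //; apply: MV; apply: lt_le_trans Mq; rewrite ltrDl.
Qed.

Lemma limsup_pinfty_gt m q0 :
  limf_esup (fun q => (f q)%:E) (pinfty_nbhs R) = l%:E -> m < l ->
  exists2 q, q0 <= q & m < f q.
Proof.
rewrite limf_esupE => fl; apply: contraPP => H; apply/negP; rewrite -leNgt.
rewrite -lee_fin -fl; apply: ge_ereal_inf.
exists (ereal_sup ((fun q => (f q)%:E) @` [set q | q0 < q])).
  by exists [set q | q0 < q] => //; exists q0; rewrite num_real.
apply: ge_ereal_sup => _ [q /= q0q <-]; rewrite lee_fin leNgt.
by apply/negP => mf; apply: H; exists q => //; exact: ltW.
Qed.
End Limsup.

Section Liminf.
Variables (R : realType) (f : R -> R) (l : R).

Let liminfN : limf_einf (fun q => (f q)%:E) (pinfty_nbhs R) = l%:E ->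
  limf_esup (fun q => (- f q)%:E) (pinfty_nbhs R) = (- l)%:E.
Proof.
move=> fl; rewrite -(_ : (\- (fun q => (f q)%:E))%E = fun q => (- f q)%:E)//.
by rewrite limf_esupN fl.
Qed.

Lemma liminf_pinfty_gt m :
  limf_einf (fun q => (f q)%:E) (pinfty_nbhs R) = l%:E -> m < l ->
  exists2 q0, 0 < q0 & forall q, q0 <= q -> m < f q.
Proof.
move=> /liminfN/limsup_pinfty_lt fl ml.
have [|q0 q00 H] := fl (- m); first by rewrite ltrN2.
by exists q0 => // q /H; rewrite ltrN2.
Qed.

Lemma liminf_pinfty_lt m q0 :
  limf_einf (fun q => (f q)%:E) (pinfty_nbhs R) = l%:E -> l < m ->
  exists2 q, q0 <= q & f q < m.
Proof.
move=> /liminfN/limsup_pinfty_gt fl lm.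
have [|q q0q H] := fl (- m) q0; first by rewrite ltrN2.
by exists q => //; rewrite -ltrN2.
Qed.
End Liminf.

(** * From limits of [phi] to lattice points with prescribed head and tail *)

Section Minima.
Variables (R : realType) (n : nat) (xi : 'I_n -> R).
Implicit Types (v w : 'rV[R]_n.+1) (q lam : R).

(** The set whose infimum is [succ_min]. *)
Let adm q j : set R := [set lam : R | 0 < lam /\
        exists M : 'M[R]_(j, n.+1), \rank M = j /\
          forall k : 'I_j, in_lattice xi (row k M) /\ in_scaled_box q lam (row k M)].

Lemma in_scaled_boxP q lam v : 0 <= lam ->
  in_scaled_box q lam v <-> hd v <= lam * expR (n%:R * q) /\ tl v <= lam * expR (- q).
Proof.
move=> l0; split=> -[h t]; split=> //.
  by apply: tl_leP => //; rewrite mulr_ge0// expR_ge0.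
by move=> i; apply: le_trans (coord_le_tl v i) t.
Qed.

(** If the head is at least 1, the long side of the box gives the bound. Otherwise the head is 0,
    the tail is at least 1, and even lam >= e^q holds. *)
Lemma box_ge q lam v : 0 <= q -> 0 < lam -> in_lattice xi v -> v != 0 ->
  in_scaled_box q lam v -> expR (- (n%:R * q)) <= lam.
Proof.
move=> q0 l0 lv v0 /(in_scaled_boxP _ _ (ltW l0))[h t].
have [h1|h1] := leP 1 (hd v).
  by rewrite expRN -div1r ler_pdivrMr ?expR_gt0// (le_trans h1).
have hv0 : hd v = 0.
  have [[|k] hk] := hd_nat lv; first by rewrite hk.
  by move: h1; rewrite hk ltNge ler1n.
have t1 := le_trans (lattice_tl_ge1 lv v0 hv0) t.
apply: le_trans (_ : expR q <= _); last first.
  by rewrite -[q]opprK expRN -div1r ler_pdivrMr ?expR_gt0.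
by rewrite ler_expR (le_trans _ q0)// oppr_le0 mulr_ge0.
Qed.

Lemma adm_ge q j lam : 0 <= q -> (0 < j)%N -> adm q j lam ->
  expR (- (n%:R * q)) <= lam.
Proof.
case: j => // j q0 _ [l0 [M [rM HM]]].
have [lv bv] := HM ord0; apply: (box_ge q0 l0 lv) bv.
apply/eqP => r0; have /row_freeP[B MB] : row_free M by rewrite /row_free rM.
have : row ord0 (M *m B) = 0 by rewrite row_mul r0 mul0mx.
by rewrite MB => /rowP/(_ ord0); rewrite !mxE eqxx => /eqP; rewrite oner_eq0.
Qed.

Lemma adm_lbound q j : 0 <= q -> (0 < j)%N -> has_lbound (adm q j).
Proof. by move=> q0 j0; exists (expR (- (n%:R * q))) => lam; exact: adm_ge. Qed.

Let C : R := 1 + \sum_(i < n) `|xi i|.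

Let C_ge1 : 1 <= C.
Proof. by rewrite lerDl sumr_ge0. Qed.

Lemma lattice_basis_bound i :
  hd (row i (lattice_basis xi)) <= 1 /\ tl (row i (lattice_basis xi)) <= C.
Proof.
have C0 : 0 <= C by apply: le_trans C_ge1.
split.
  rewrite /hd !mxE unlift_none; case: (i == ord0); rewrite /= ?oppr0 ?normr0 ?normr1//.
apply: tl_leP => // k; rewrite !mxE liftK; case: (i == ord0) => /=.
  rewrite /C (bigD1 k)//= addrCA lerDl addr_ge0// sumr_ge0//.
by apply: le_trans C_ge1; rewrite normrN; case: (i == _); rewrite ?normr1 ?normr0.
Qed.

Lemma adm_basis q : 0 <= q -> adm q n.+1 (C * expR q).
Proof.
move=> q0; have C0 : 0 < C by apply: lt_le_trans C_ge1.
split; first by rewrite mulr_gt0// expR_gt0.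
exists (lattice_basis xi); split; first by rewrite mxrank_unit// lattice_basis_unit.
move=> k; split; first exact: in_lattice_basis.
apply/in_scaled_boxP; first by rewrite mulr_ge0// ?expR_ge0// ltW.
have [h t] := lattice_basis_bound k; split.
  apply: le_trans h _; rewrite -mulrA -expRD -[1]mulr1 ler_pM//.
  by rewrite -[leLHS]expR0 ler_expR addr_ge0// mulr_ge0.
by rewrite -mulrA -expRD subrr expR0 mulr1.
Qed.

Lemma adm_anti q j k : (j <= k)%N -> adm q k `<=` adm q j.
Proof.
move=> jk lam [l0 [M [rM HM]]]; split=> //.
exists (rowsub (widen_ord jk) M); split; last by move=> i; rewrite row_rowsub; exact: HM.
have /row_freeP[B MB] : row_free M by rewrite /row_free rM.
apply/eqP; rewrite -/(row_free _).
have wi : injective (widen_ord jk) by move=> a b /(congr1 val)/= ab; exact: val_inj.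
apply/row_freeP; exists (B *m (rowsub (widen_ord jk) 1%:M)^T).
rewrite mulmxA mul_rowsub_mx MB; apply/matrixP => a b.
rewrite !mxE (bigD1 (widen_ord jk b))//= big1 => [|c cb]; rewrite !mxE.
  by rewrite eqxx mulr1 addr0 (inj_eq wi).
by rewrite [_ b == c]eq_sym (negbTE cb) mulr0.
Qed.

Lemma adm_neq0 q j : 0 <= q -> (j <= n.+1)%N -> adm q j !=set0.
Proof. by move=> q0 jn; exists (C * expR q); apply: (adm_anti jn); exact: adm_basis. Qed.

(** Both [inf] of an empty set and [ln] outside the positive reals take default values. Positivity,
    together with [adm_neq0], ensures that [phi] has its intended meaning. *)
Lemma succ_min_gt0 q j : 0 <= q -> (0 < j <= n.+1)%N -> 0 < succ_min xi q j.
Proof.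
move=> q0 /andP[j0 jn]; apply: (@lt_le_trans _ _ (expR (- (n%:R * q)))).
  exact: expR_gt0.
by apply: lb_le_inf; [exact: adm_neq0|move=> lam; exact: adm_ge].
Qed.

Lemma phi_lt q j m : 0 < q -> (0 < j <= n.+1)%N -> phi xi j q < m ->
  exists2 lam, adm q j lam & lam < expR (m * q).
Proof.
move=> q0 jn; rewrite /phi ltr_pdivrMr// -ltr_expR lnK ?posrE ?succ_min_gt0 ?ltW//.
by apply: inf_lt; apply: adm_neq0; [exact: ltW|case/andP: jn].
Qed.

Lemma phi_gt q j m lam : 0 < q -> (0 < j <= n.+1)%N -> m < phi xi j q ->
  adm q j lam -> expR (m * q) <= lam.
Proof.
move=> q0 jn; rewrite /phi ltr_pdivlMr// -ltr_expR lnK ?posrE ?succ_min_gt0 ?(ltW q0)//.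
move=> h al; apply/ltW; apply: (lt_le_trans h); apply: ge_inf => //.
by apply: adm_lbound; [exact: ltW|case/andP: jn].
Qed.

Lemma adm1 q lam v : 0 < lam -> in_lattice xi v -> v != 0 -> in_scaled_box q lam v ->
  adm q 1 lam.
Proof.
move=> l0 lv v0 bv; split=> //; exists v; split; first by rewrite rank_rV v0.
by move=> k; rewrite row_id.
Qed.

Variables (s t nu : R).
Hypothesis liminf1 : phi_liminf xi 1 = s%:E.
Hypothesis limsup1 : phi_limsup xi 1 = t%:E.
Hypothesis limsupn : phi_limsup xi n.+1 = nu%:E.

(** A point violating the conclusion would push the first minimum below e^(s1 q), against the lower
    limit. This is the finiteness of the ordinary exponent of approximation. *)
Lemma first_min_lower s1 : s1 < s -> exists2 q0, 0 < q0 &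
  forall q v, q0 <= q -> in_lattice xi v -> v != 0 -> tl v < expR ((s1 - 1) * q) ->
    expR ((n%:R + s1) * q) <= hd v.
Proof.
move=> /(liminf_pinfty_gt liminf1)[q0 q00 H]; exists q0 => // q v q0q lv v0 tv.
have qp : 0 < q by apply: lt_le_trans q0q.
rewrite leNgt; apply/negP => hv.
(* The least factor for which the scaled box contains v. *)
pose lam := Num.max (hd v * expR (- (n%:R * q))) (tl v * expR q).
have lam_lt : lam < expR (s1 * q).
  rewrite /lam gt_max; apply/andP; split.
    by rewrite expRN ltr_pdivrMr ?expR_gt0// -expRD -mulrDl addrC.
  by rewrite -ltr_pdivlMr ?expR_gt0// -expRN -expRD -[X in _ - X]mul1r -mulrBl.
have lam0 : 0 < lam.
  rewrite lt_max; have [h0|h0] := eqVneq (hd v) 0.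
    rewrite [X in _ || X]mulr_gt0 ?orbT ?expR_gt0//.
    by apply: lt_le_trans (lattice_tl_ge1 lv v0 h0).
  by rewrite mulr_gt0 ?expR_gt0// lt_neqAle eq_sym h0 hd_ge0.
move: lam_lt; rewrite ltNge; apply/negP; rewrite negbK.
apply: (phi_gt qp _ (H _ q0q)) => //; apply: (adm1 lam0 lv v0).
apply/in_scaled_boxP; first exact: ltW.
rewrite -!ler_pdivrMr ?expR_gt0// -!expRN opprK; split; by rewrite /lam le_max lexx ?orbT.
Qed.

Let phi1_lt q m : 0 < q -> phi xi 1 q < m -> exists v,
  [/\ in_lattice xi v, v != 0, hd v < expR ((n%:R + m) * q) & tl v < expR ((m - 1) * q)].
Proof.
move=> q0 /(@phi_lt q 1 m q0 isT)[lam [l0 [v [rv Hv]]] lm]; exists v.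
have [lv bv] := Hv ord0; rewrite row_id in lv bv.
have [h t'] := (in_scaled_boxP q v (ltW l0)).1 bv.
split => //; first by move: rv; rewrite rank_rV; case: eqP.
  by apply: le_lt_trans h _; rewrite mulrDl addrC expRD ltr_pM2r// expR_gt0.
by apply: le_lt_trans t' _; rewrite mulrBl mul1r expRD ltr_pM2r// expR_gt0.
Qed.

Lemma first_min_often s2 q0 : s < s2 -> exists2 q, q0 <= q & exists v,
  [/\ in_lattice xi v, v != 0, hd v < expR ((n%:R + s2) * q) & tl v < expR ((s2 - 1) * q)].
Proof.
move=> /(liminf_pinfty_lt (Num.max 1 q0) liminf1)[q]; rewrite ge_max => /andP[q1 q0q] H.
by exists q => //; apply: phi1_lt => //; apply: lt_le_trans q1.
Qed.

(** With X = e^((n + t1) q) this gives a point of head below X and tail below X^(-w), where w = (1 -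
    t1) / (n + t1): the uniform exponent in parametric form. *)
Lemma first_min_upper t1 : t < t1 -> exists2 q0, 0 < q0 & forall q, q0 <= q -> exists v,
  [/\ in_lattice xi v, v != 0, hd v < expR ((n%:R + t1) * q) & tl v < expR ((t1 - 1) * q)].
Proof.
move=> /(limsup_pinfty_lt limsup1)[q0 q00 H]; exists q0 => // q q0q.
by apply: phi1_lt; [exact: lt_le_trans q0q|exact: H].
Qed.

Lemma last_min_upper nu1 : nu < nu1 -> exists2 q0, 0 < q0 &
  forall q, q0 <= q -> exists W : seq 'rV[R]_n.+1, (forall v, v \in << W >>%VS) /\
    forall w, w \in W -> [/\ in_lattice xi w, hd w <= expR ((n%:R + nu1) * q) &
                          tl w <= expR ((nu1 - 1) * q)].
Proof.
move=> /(limsup_pinfty_lt limsupn)[q0 q00 H]; exists q0 => // q q0q.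
have qp : 0 < q by apply: lt_le_trans q0q.
have jn : (0 < n.+1 <= n.+1)%N by rewrite /=.
have [lam [l0 [M [rM HM]]] lm] := phi_lt qp jn (H _ q0q).
exists [seq row i M | i : 'I_n.+1]; split=> [v|_ /mapP[i _ ->]].
  by apply: span_row_full; rewrite -row_free_unit /row_free rM.
have [lv /(in_scaled_boxP _ _ (ltW l0))[h t']] := HM i; split=> //.
  by apply: le_trans h _; rewrite mulrDl addrC expRD ler_pM2r ?expR_gt0// ltW.
by apply: le_trans t' _; rewrite mulrBl mul1r expRD ler_pM2r ?expR_gt0// ltW.
Qed.

(** The fixed basis [lattice_basis] lies in the box scaled by C e^q, so the last minimum is at most
    C e^q. *)
Lemma last_min_le1 : nu <= 1.
Proof.
rewrite leNgt; apply/negP => nu1; pose m := (1 + nu) / 2.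
have m1 : 1 < m by rewrite /m; lra.
have mnu : m < nu by rewrite /m; lra.
have jn : (0 < n.+1 <= n.+1)%N by rewrite /=.
(* Beyond ln C / (m - 1) the bound C e^q is smaller than e^(m q). *)
have [q] := limsup_pinfty_gt (Num.max 1 (ln C / (m - 1) + 1)) limsupn mnu.
rewrite ge_max => /andP[q1 qC] H.
have qp : 0 < q by apply: lt_le_trans q1.
have := phi_gt qp jn H (adm_basis (ltW qp)).
have C0 : 0 < C by apply: lt_le_trans C_ge1.
rewrite -{1}(lnK C0) -expRD ler_expR -lerBlDr leNgt; apply/negP; rewrite negbK.
rewrite -[X in _ - X]mul1r -mulrBl mulrC -ltr_pdivrMr ?subr_gt0//.
by apply: lt_le_trans qC; rewrite ltrDl.
Qed.

End Minima.

(** * Absorbing constants, points of least head, and reduction modulo a point *)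

Lemma expR_small (R : realType) (K e : R) : 0 < e ->
  exists Q, forall q, Q <= q -> K * expR (- e * q) < 1.
Proof.
move=> e0; exists (K / e) => q; rewrite ler_pdivrMr// mulrC => Kq.
rewrite mulNr expRN ltr_pdivrMr ?expR_gt0// mul1r; apply: le_lt_trans Kq _.
by apply: lt_le_trans (expR_ge1Dx _); rewrite ltrDr.
Qed.

Section Reduction.
Variables (R : realType) (n : nat) (xi : 'I_n -> R).
Implicit Types (v w : 'rV[R]_n.+1).

Lemma lattice_min_hd (P : 'rV[R]_n.+1 -> Prop) :
  (exists v, in_lattice xi v /\ P v) ->
  exists v, [/\ in_lattice xi v, P v &
    forall w, in_lattice xi w -> P w -> hd v <= hd w].
Proof.
move=> [v0 [lv0 Pv0]].
pose A k := `[< exists v, [/\ in_lattice xi v, P v & hd v = k%:R] >].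
have exA : exists k, A k.
  by have [k hk] := hd_nat lv0; exists k; apply/asboolP; exists v0.
case: (ex_minnP exA) => k /asboolP[v [lv Pv hv]] mk.
exists v; split=> // w lw Pw; have [m hw] := hd_nat lw.
by rewrite hv hw ler_nat mk//; apply/asboolP; exists w.
Qed.

Lemma free2N v w : w != 0 -> ~~ free [:: v; w] -> exists k, v = k *: w.
Proof.
move=> w0; rewrite free_cons seq1_free w0 andbT negbK span_seq1.
by move/vlineP => [k ->]; exists k.
Qed.

(** Subtracting from each w the integer part of w_0 / z_0 times z brings its head below that of z.
    The multiplier is at most x / hd z + 1 in absolute value, which bounds the growth of the tail.
    Keeping z itself in the family preserves the span. *)
Lemma reduce_spanning z (W : seq 'rV[R]_n.+1) (x y : R) :
  in_lattice xi z -> 0 < hd z -> 0 <= x -> 0 <= y -> (forall v, v \in << W >>%VS) ->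
  (forall w, w \in W -> [/\ in_lattice xi w, hd w <= x & tl w <= y]) ->
  exists W' : seq 'rV[R]_n.+1, (forall v, v \in << W' >>%VS) /\
    forall w, w \in W' ->
      [/\ in_lattice xi w, hd w <= hd z & tl w <= y + (x / hd z + 1) * tl z].
Proof.
move=> lz hz x0 y0 fW HW.
pose k w : int := Num.floor (w ord0 ord0 / z ord0 ord0).
have z0 : z ord0 ord0 != 0 by rewrite -normr_gt0.
exists (z :: [seq w - (k w)%:~R *: z | w <- W]); split.
  have sub : (<< W >> <= << z :: [seq w - (k w)%:~R *: z | w <- W] >>)%VS.
    apply/span_subvP => w wW; rewrite -(subrK ((k w)%:~R *: z) w).
    apply: rpredD.
      by apply/memv_span; rewrite inE; apply/orP; right; apply/mapP; exists w.
    by apply/rpredZ/memv_span/mem_head.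
  by move=> v; exact: (subvP sub _ (fW v)).
have xz : 0 <= x / hd z by apply: divr_ge0 => //; exact: ltW.
move=> w; rewrite inE => /predU1P[->|/mapP[u uW ->]].
  split=> //; apply: le_trans (_ : 1 * tl z <= _); first by rewrite mul1r.
  by rewrite mulrDl addrA lerDr addr_ge0// mulr_ge0// tl_ge0.
have [lu hu tu] := HW _ uW; split.
- by apply: in_latticeB => //; exact: in_latticeZ.
- rewrite /hd !mxE -[u ord0 ord0](divfK z0) -mulrBl normrM ler_piMl//.
  have := floor_le (u ord0 ord0 / z ord0 ord0).
  have := floorD1_gt (u ord0 ord0 / z ord0 ord0).
  rewrite intrD -/(k u) => h1 h2; rewrite ger0_norm ?subr_ge0//.
  by rewrite lerBlDl ltW.
- apply: le_trans (tlB _ _) _; rewrite lerD// (le_trans (tlZ _ _))// ler_wpM2r// ?tl_ge0//.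
  apply: le_trans (_ : `|u ord0 ord0 / z ord0 ord0| + 1 <= _).
    have := floor_le (u ord0 ord0 / z ord0 ord0).
    have := floorD1_gt (u ord0 ord0 / z ord0 ord0).
    have := ler_norm (u ord0 ord0 / z ord0 ord0).
    have := ler_norm (- (u ord0 ord0 / z ord0 ord0)).
    rewrite intrD -/(k u) normrN ler_norml.
    set c := `|_|; set d := _ / _; set m := (k u)%:~R => *.
    by apply/andP; split; lra.
  by rewrite lerD2r normrM normfV ler_wpM2r// invr_ge0 normr_ge0.
Qed.

End Reduction.

(** * Determinant arguments: n nu + s >= 0, and the contradiction behind the upper bound *)

Section Exponents.
Variables (R : realType) (n : nat) (xi : 'I_n -> R).
Hypothesis n2 : (2 <= n)%N.
Variables (s nu : R).
Hypothesis liminf1 : phi_liminf xi 1 = s%:E.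
Hypothesis limsupn : phi_limsup xi n.+1 = nu%:E.

(** A point realising s, completed by n vectors from the last minimum, has determinant of order at
    most e^((n nu + s) q) up to perturbation, which must not tend to 0. *)
Lemma last_min_ge : - s / n%:R <= nu.
Proof.
have n0 : (0 : R) < n%:R by rewrite ltr0n; case: (n) n2.
rewrite leNgt; apply/negP; rewrite ltr_pdivlMr// => h.
(* Perturbing s and nu by e adds e (n + 1) to the exponent n nu + s; this choice uses up half of the
   gap. *)
pose e : R := - (nu * n%:R + s) / (2 * (n%:R + 1)).
have n1 : (0 : R) < 2 * (n%:R + 1) by lra.
have e0 : 0 < e by rewrite divr_gt0//; lra.
have eE : e * (n%:R + 1) = - (nu * n%:R + s) / 2.
  by rewrite /e; field; rewrite gt_eqF//; lra.
have es : s < s + e by rewrite ltrDl.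
have enu : nu < nu + e by rewrite ltrDl.
have [q4 q40 H4] := last_min_upper limsupn enu.
pose K : R := (n.+1)`!%:R * (n%:R + 1).
have ee0 : 0 < e * (n%:R + 1) by rewrite mulr_gt0//; lra.
have [Q HQ] := expR_small K ee0.
have [q] := first_min_often liminf1 (Num.max q4 Q) es.
rewrite ge_max => /andP[q4q Qq] [z [lz z0 hz tz]].
have [W [fW HW]] := H4 _ q4q.
have fz : free [:: z] by rewrite seq1_free.
have lz' v : v \in [:: z] -> in_lattice xi v by rewrite inE => /eqP ->.
have := lattice_minkowski fz lz' fW HW.
rewrite leNgt => /negP; apply; apply: le_lt_trans (HQ _ Qq).
rewrite /K -[leRHS]mulrA ler_wpM2l//= subn1 /= mulr0 addr0 !mulr1.
rewrite [leRHS]mulrDl mul1r -!expRM_natl lerD//.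
  rewrite -!mulrA ler_wpM2l//.
  apply: le_trans (_ : expR ((n%:R + (nu + e)) * q) *
    (expR ((n - 1)%:R * ((nu + e - 1) * q)) * expR ((s + e - 1) * q)) <= _).
    rewrite !ler_wpM2l ?expR_ge0//; exact: ltW.
  rewrite -!expRD ler_expR natrB ?(ltnW n2)// le_eqVlt; apply/orP; left; apply/eqP.
  transitivity ((nu * n%:R + s + e * (n%:R + 1)) * q); first by ring.
  by rewrite eE; field.
apply: le_trans (_ : expR (n%:R * ((nu + e - 1) * q)) * expR ((n%:R + (s + e)) * q) <= _).
  by rewrite ler_wpM2l ?expR_ge0//; exact: ltW.
rewrite -!expRD ler_expR le_eqVlt; apply/orP; left; apply/eqP.
transitivity ((nu * n%:R + s + e * (n%:R + 1)) * q); first by ring.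
by rewrite eE; field.
Qed.

End Exponents.

(* [d] and [h] have the limiting values 0 and 1 - nu, and every inequality
   between the parameters is a strict perturbation of the limiting one.
   The point z realises liminf phi_1 at q; x has the least first coordinate
   among the points with tail below the threshold e^((d - w a) q); x' is a good
   approximation for the parameter at which x stops being admissible. *)
Lemma extremal_contradiction (R : realType) (n : nat) (xi : 'I_n -> R)
    (s t nu s1 s2 t1 nu1 d h : R) :
  (2 <= n)%N -> phi_liminf xi 1 = s%:E -> phi_limsup xi 1 = t%:E ->
  phi_limsup xi n.+1 = nu%:E ->
  let N := n%:R in let w := (1 - t1) / (N + t1) in
  let a1 := (N + s1) * (1 - s2) / (1 - s1) in
  let b1 := (w * a1 - d) * (N + s1) / (1 - s1) in
  s1 < s -> s < s2 -> t < t1 -> nu < nu1 -> s2 < 1 ->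
  0 < N + s1 -> 0 < N + t1 -> t1 < 1 -> w < 1 -> 0 < d -> d < w * a1 ->
  h < 1 - nu1 -> h < 1 - s2 -> h < a1 + 1 - s2 - N - nu1 ->
  (1 - w) * (N + s2 - d / w) < (N - 1) * h ->
  (1 - w) * (N + s2) + d - w * b1 < (N - 2) * h -> False.
Proof.
move=> n2 liminf1 limsup1 limsupn N w a1 b1 s1s ss2 tt1 nunu1 s21 Ns1 Nt1 t11 w1 d0 dwa hnu hs2 ha hI hII.
have s11 : 0 < 1 - s1 by lra.
have w0 : 0 < w by rewrite divr_gt0//; lra.
have a10 : 0 < a1 by rewrite divr_gt0// mulr_gt0//; lra.
have b10 : 0 < b1 by rewrite divr_gt0// mulr_gt0//; lra.
have N2 : 2 <= N by rewrite ler_nat.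
have N1 : 0 <= N - 1 by lra.
have w1' : 0 <= 1 - w by lra.
have wd0 : 0 < w * a1 - d by lra.
have s2N : s2 - 1 < 0 by lra.
have [q1 q10 H1] := first_min_lower liminf1 s1s.
have [q3 q30 H3] := first_min_upper limsup1 tt1.
have [q4 q40 H4] := last_min_upper limsupn nunu1.
(* [eta] is the margin in the last two hypotheses and will absorb the determinant constant [K];
   [eta'] is the margin in the three bounds on h and will absorb a factor 3. *)
pose eta := Num.min ((N - 1) * h - (1 - w) * (N + s2 - d / w))
                    ((N - 2) * h - ((1 - w) * (N + s2) + d - w * b1)).
have eta0 : 0 < eta by rewrite lt_min !subr_gt0 hI hII.
pose eta' := Num.min (1 - nu1 - h) (Num.min (1 - s2 - h) (a1 + 1 - s2 - N - nu1 - h)).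
have eta'0 : 0 < eta' by rewrite !lt_min !subr_gt0 hnu hs2 ha.
pose K : R := (n.+1)`!%:R * (N + 1).
have [eta1 eta2] : eta <= (N - 1) * h - (1 - w) * (N + s2 - d / w) /\
    eta <= (N - 2) * h - ((1 - w) * (N + s2) + d - w * b1).
  by rewrite !ge_min !lexx orbT.
have [e1 e2 e3] : [/\ eta' <= 1 - nu1 - h, eta' <= 1 - s2 - h &
                eta' <= a1 + 1 - s2 - N - nu1 - h].
  by rewrite !ge_min !lexx !orbT.
have wE : w * (N + t1) = 1 - t1 by rewrite divfK// gt_eqF.
have b1E : b1 * (1 - s1) = (w * a1 - d) * (N + s1) by rewrite divfK// gt_eqF.
have a1E : a1 * (1 - s1) = (N + s1) * (1 - s2) by rewrite divfK// gt_eqF.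
have s11' : 1 - s1 != 0 by rewrite gt_eqF.
have Nt1' : N + t1 != 0 by rewrite gt_eqF.
clearbody eta eta' w b1 a1.
have [Q1 HQ1] := expR_small K eta0.
have [Q2 HQ2] := expR_small (3 : R) eta'0.
(* The limit lemmas will be applied at four parameters other than q: to bound the head of z, to find
   x, to bound the head of x, and to find x'. They are at least c1 q, c2 q, c3 q and c4 q
   respectively, so q is taken large enough for all of them. *)
pose c1 := (1 - s2) / (1 - s1).
have c10 : 0 < c1 by rewrite divr_gt0//; lra.
pose c2 := a1 / (N + t1).
have c20 : 0 < c2 by rewrite divr_gt0.
pose c3 := (w * a1 - d) / (1 - s1).
have c30 : 0 < c3 by rewrite divr_gt0//; lra.
pose c4 := b1 / (N + t1).
have c40 : 0 < c4 by rewrite divr_gt0.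
have [q] := first_min_often liminf1 (\big[Num.max/1]_(x <- [:: q4; q1 / c1; q3 / c2; q1 / c3; q3 / c4; Q1; Q2]) x) ss2.
rewrite !big_cons big_nil !ge_max !ler_pdivrMr//.
case/and5P => q4q q1q q3q q1q' /and4P[q3q' Q1q Q2q qge1] [z [lz z0 hz tz]].
have q0 : 0 < q by apply: lt_le_trans qge1.
pose E x := expR (x * q).
have E0 x : 0 < E x by exact: expR_gt0.
have ED x y : E (x + y) = E x * E y by rewrite /E mulrDl expRD.
have Ele x y : (E x <= E y) = (x <= y) by rewrite /E ler_expR ler_pM2r.
have Elt x y : (E x < E y) = (x < y) by rewrite /E ltr_expR ltr_pM2r.
have EX k x : E x ^+ k = E (k%:R * x) by rewrite /E -expRM_natl mulrA.
have E00 : E 0 = 1 by rewrite /E mul0r expR0.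
have Elog x : 1 <= x -> x = E (ln x / q).
  by move=> x1; rewrite /E divfK ?gt_eqF// lnK// posrE (lt_le_trans ltr01).
have hz1 : 1 <= hd z.
  by apply: (hd_ge1 lz z0); apply: lt_trans tz _; rewrite -[ltRHS]E00 Elt.
set a := ln (hd z) / q; have hzE : hd z = E a by exact: Elog.
have aN : a < N + s2 by rewrite -Elt -hzE.
have a1a : a1 <= a.
  rewrite -Ele -hzE; have -> : E a1 = expR ((N + s1) * (q * c1)).
    by congr expR; rewrite /c1 -[a1](mulfK s11') a1E; field.
  apply: (H1 _ _ q1q lz z0); rewrite (_ : (s1 - 1) * (q * c1) = (s2 - 1) * q)//.
  by rewrite /c1; field.
have [W [fW HW]] := H4 _ q4q.
have [|||W' [fW' HW']] := reduce_spanning lz _ _ _ fW HW; rewrite ?expR_ge0//.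
  exact: lt_le_trans hz1.
(* Each of the three summands in the tail bound of the reduced vectors is at most E (- h - eta'). *)
have {}HW' v : v \in W' -> [/\ in_lattice xi v, hd v <= E a & tl v <= E (- h)].
  move=> /HW'[lv hv tv]; split=> //; first by rewrite -hzE.
  apply: le_trans tv _; rewrite hzE -/(E _) -/(E _) mulrDl mul1r.
  have h3 : 3 * E (- eta') <= 1 by apply/ltW/HQ2.
  have k1 : E (nu1 - 1) <= E (- h - eta') by rewrite Ele; clear - e1; lra.
  have k2 : tl z <= E (- h - eta') by apply/ltW/(lt_le_trans tz); rewrite Ele; clear - e2; lra.
  have k3 : E (N + nu1) / E a * tl z <= E (- h - eta').
    have -> : (E a)^-1 = E (- a) by rewrite /E mulNr expRN.
    rewrite -ED; apply: le_trans (_ : E (N + nu1 - a) * E (s2 - 1) <= _).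
      by rewrite ler_wpM2l// ltW.
    by rewrite -ED Ele; clear - e3 a1a; lra.
  apply: le_trans (_ : E (- h) * (3 * E (- eta')) <= _).
    by rewrite mulrCA -ED; clear - k1 k2 k3; lra.
  by rewrite ler_piMr// ltW.
(* Such points exist: the uniform exponent at the parameter a q / (N + t1) gives a tail below E (- w
   a). *)
have [x [lx [x0 tx] minx]] : exists v, [/\ in_lattice xi v, v != 0 /\ tl v < E (d - w * a) &
    forall u, in_lattice xi u -> u != 0 /\ tl u < E (d - w * a) -> hd v <= hd u].
  apply: (lattice_min_hd (P := fun v => v != 0 /\ tl v < E (d - w * a))).
  have ra : q3 <= a * q / (N + t1).
    by apply: le_trans q3q _; rewrite /c2 mulrA ler_pM2r ?invr_gt0// mulrC ler_pM2r//.
  have [v [lv v0 _ tv]] := H3 _ ra; exists v; split=> //; split=> //.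
  apply: lt_trans tv _; rewrite -/(E _) (_ : (t1 - 1) * _ = (- w * a) * q); last first.
    by rewrite -[w](mulfK Nt1') wE; field.
  by rewrite -/(E _) Elt; clear - d0; lra.
have wa : w * a1 <= w * a by rewrite ler_pM2l.
have hx1 : 1 <= hd x.
  by apply: (hd_ge1 lx x0); apply: lt_trans tx _; rewrite -[ltRHS]E00 Elt subr_lt0; apply: lt_le_trans dwa wa.
set b := ln (hd x) / q; have hxE : hd x = E b by exact: Elog.
have b1b : b1 <= b.
  rewrite -Ele -hxE; apply: le_trans (_ : E ((w * a - d) * (N + s1) / (1 - s1)) <= _).
    by rewrite Ele ler_pdivlMr// b1E ler_pM2r// lerD2r.
  pose q' := (w * a - d) / (1 - s1) * q.
  have -> : E ((w * a - d) * (N + s1) / (1 - s1)) = expR ((N + s1) * q').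
    by congr expR; rewrite /q'; field.
  apply: (H1 _ _ _ lx x0).
    by apply: le_trans q1q' _; rewrite /q' mulrC ler_pM2r// /c3 ler_pM2r ?invr_gt0// lerD2r.
  by rewrite (_ : (s1 - 1) * q' = (d - w * a) * q)// /q'; field.
have [x' [lx' x'0 hx' tx']] : exists v, [/\ in_lattice xi v, v != 0, hd v < E b &
    tl v < E (- w * b)].
  have rb : q3 <= b * q / (N + t1).
    by apply: le_trans q3q' _; rewrite /c4 mulrA ler_pM2r ?invr_gt0// mulrC ler_pM2r//.
  have [v [lv v0 hv tv]] := H3 _ rb; exists v; split=> //.
    rewrite (_ : E b = expR ((N + t1) * (b * q / (N + t1))))//.
    by congr expR; field.
  rewrite (_ : E (- w * b) = expR ((t1 - 1) * (b * q / (N + t1))))//.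
  by congr expR; rewrite -[w](mulfK Nt1') wE; field.
(* The head of x' is smaller than that of x, so minimality of x excludes x' from the competition. *)
have thr : E (d - w * a) <= tl x'.
  rewrite leNgt; apply/negP => th.
  by have := minx _ lx' (conj x'0 th); rewrite hxE leNgt hx'.
have wab : d - w * a < - w * b by rewrite -Elt; apply: le_lt_trans thr tx'.
(* If x' = k x, comparing heads gives |k| <= 1, and then the tail of x' would be below the
   threshold. *)
have fr : free [:: x'; x].
  apply/negPn/negP => /(free2N x0)[k kE].
  have k1 : `|k| <= 1.
    have hx0 : 0 < hd x by apply: lt_le_trans hx1.
    by move: hx'; rewrite -hxE kE hdZ -ltr_pdivlMr// divff ?gt_eqF// => /ltW.
  move: thr; rewrite leNgt => /negP; apply; rewrite kE.
  apply: le_lt_trans (tlZ _ _) _; apply: le_lt_trans tx.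
  by rewrite ler_piMl// tl_ge0.
have lxx v : v \in [:: x'; x] -> in_lattice xi v.
  by rewrite !inE => /orP[]/eqP ->.
have := lattice_minkowski fr lxx fW' HW'.
rewrite leNgt => /negP; apply; apply: le_lt_trans (HQ1 _ Q1q).
rewrite -/(E _) /K -[leRHS]mulrA ler_wpM2l//= mulr0 addr0 !mulr1 !EX.
have subE k m : (m <= k)%N -> (k - m)%:R = k%:R - m%:R :> R by exact: natrB.
rewrite !subE ?(leq_trans n2)//.
have -> : n.+1%:R - 2 = N - 1 :> R by rewrite -natr1 /N; ring.
(* The determinant bound splits into N - 1 terms whose head comes from a reduced vector and two
   whose head comes from x' or x. *)
have -> : (N + 1) * E (- eta) = (N - 1) * E (- eta) + (E (- eta) + E (- eta)) by ring.
apply: lerD.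
  rewrite -!mulrA ler_wpM2l//.
  apply: le_trans (_ : E a * (E ((N - 2) * - h) * (E (- w * b) * E (d - w * a))) <= _).
    rewrite ler_pM2l// ler_pM2l// ler_pM ?tl_ge0//; exact: ltW.
  rewrite -!ED Ele.
  have : (1 - w) * a <= (1 - w) * (N + s2) by rewrite ler_wpM2l// ltW.
  have : w * b1 <= w * b by rewrite ler_wpM2l// ltW.
  by clear - eta2; lra.
(* The tail of x' lies between E (d - w a) and E (- w b), so b < a - d / w. Without the slack d the
   exponent of the two remaining terms would tend to 0 in the extremal case; d makes it negative. *)
have wb : (1 - w) * b <= (1 - w) * (N + s2 - d / w).
  rewrite ler_wpM2l//.
  rewrite -(ler_pM2l w0) (_ : w * (_ - _) = w * (N + s2) - d); last first.
    by field; rewrite gt_eqF.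
  have : w * a <= w * (N + s2) by rewrite ler_wpM2l// ltW.
  by clear - wab; lra.
apply: le_trans (_ : E ((N - 1) * - h) * (E b * E (- w * b) + E (- w * b) * E b) <= _).
  rewrite ler_pM2l//; apply: lerD; rewrite ler_pM ?tl_ge0 ?hd_ge0 ?hxE//; try exact: ltW.
  by apply/ltW/(lt_trans tx); rewrite Elt.
rewrite [E (- w * b) * _]mulrC mulrDr -!ED; apply: lerD; rewrite Ele; clear - wb eta1; lra.
Qed.

(** * The uniform exponent differs from 1 *)

Lemma bernoulli (R : realDomainType) (x : R) m : 0 <= x -> 1 + m%:R * x <= (1 + x) ^+ m.
Proof.
move=> x0; elim: m => [|m ih]; first by rewrite mul0r addr0 expr0.
rewrite exprS -natr1; apply: le_trans (_ : (1 + x) * (1 + m%:R * x) <= _).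
  have : 0 <= m%:R * x * x by rewrite !mulr_ge0.
  lra.
by rewrite ler_wpM2l// addr_ge0.
Qed.

(** The least power reaching K works, since the preceding power is still below K. *)
Lemma geometric_window (R : realType) (x K : R) : 0 < x -> 1 <= K ->
  exists m, K <= (1 + x) ^+ m <= (1 + x) * K.
Proof.
move=> x0 K1.
have ex : exists m, K <= (1 + x) ^+ m.
  have [m Km] : exists m : nat, K / x <= m%:R.
    by exists (Num.truncn (K / x)).+1; apply/ltW/truncnS_gt.
  exists m; apply: le_trans (bernoulli m (ltW x0)).
  by move: Km; rewrite ler_pdivrMr//; lra.
case: (ex_minnP ex) => m Km mm; exists m; rewrite Km /=.
case: m Km mm => [|m] Km mm; first by rewrite expr0 (le_trans K1)// ler_peMl//; lra.
rewrite exprS ler_pM2l; last lra.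
by rewrite leNgt; apply/negP => /ltW /mm; rewrite ltnn.
Qed.

Section Uniform.
Variables (R : realType) (n : nat) (xi : 'I_n -> R).
Implicit Types (v w : 'rV[R]_n.+1).

(** The integer coordinates of two points satisfy a common nontrivial rational equation c0 x + sum
    c_i y_i = 0, because n + 1 > 2. Substituting y_i = xi_i x - z_i gives the stated identity, which
    is linear in the point and so extends to the real span. *)
Lemma rational_annihilator v w : (2 <= n)%N -> in_lattice xi v -> in_lattice xi w ->
  exists (c0 : rat) (c : 'I_n -> rat), ~ (c0 = 0 /\ forall i, c i = 0) /\
    forall x, x \in << [:: v; w] >>%VS -> x ord0 ord0 * (ratr c0 + \sum_i ratr (c i) * xi i)
      = \sum_i ratr (c i) * x ord0 (lift ord0 i).
Proof.
move=> n2 [x [y [v0 vi]]] [x' [y' [w0 wi]]].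
pose A : 'M[rat]_(n.+1, 2) := \matrix_(j, k)
  (if k == ord0 then oapp y x (unlift ord0 j) else oapp y' x' (unlift ord0 j))%:~R.
have /rowV0Pn[u /sub_kermxP uA u0] : kermx A != 0.
  by rewrite -mxrank_eq0 mxrank_ker subn_eq0 -ltnNge ltnS (leq_trans (rank_leq_col _)).
have uE k : u ord0 ord0 * A ord0 k + \sum_i u ord0 (lift ord0 i) * A (lift ord0 i) k = 0.
  by move/matrixP/(_ ord0 k): uA; rewrite mxE [RHS]mxE big_ord_recl.
exists (u ord0 ord0), (fun i => u ord0 (lift ord0 i)); split.
  move=> [c0 ci]; case/eqP: u0; apply/rowP => j; rewrite mxE.
  by have [->|[i ->]] := coordP v j.
pose c0 : R := ratr (u ord0 ord0); pose c i : R := ratr (u ord0 (lift ord0 i)).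
pose L (z : 'rV[R]_n.+1) := z ord0 ord0 * (c0 + \sum_i c i * xi i) - \sum_i c i * z ord0 (lift ord0 i).
have LE (z : 'rV[R]_n.+1) (x1 : int) (y1 : 'I_n -> int) : z ord0 ord0 = x1%:~R ->
    (forall i, z ord0 (lift ord0 i) = xi i * x1%:~R - (y1 i)%:~R) ->
    L z = c0 * x1%:~R + \sum_i c i * (y1 i)%:~R.
  move=> z0 zi; rewrite /L z0 mulrDr [_ * c0]mulrC -addrA; congr (_ + _).
  rewrite mulr_sumr -sumrB; apply: eq_bigr => i _; rewrite zi; ring.
have L0 (x1 : int) (y1 : 'I_n -> int) : (u ord0 ord0) * x1%:~R + \sum_i u ord0 (lift ord0 i) * (y1 i)%:~R = 0 ->
    c0 * x1%:~R + \sum_i c i * (y1 i)%:~R = 0.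
  move=> /(congr1 (@ratr R)); rewrite rmorph0 rmorphD rmorphM rmorph_sum /= ratr_int => e.
  rewrite -[RHS]e; congr (_ + _); apply: eq_bigr => i _.
  by rewrite rmorphM /= ratr_int.
have Lv : L v = 0.
  rewrite (LE _ _ _ v0 vi); apply: L0; rewrite -[RHS](uE ord0) !mxE unlift_none /=.
  by congr (_ + _); apply: eq_bigr => i _; rewrite !mxE liftK.
have Lw : L w = 0.
  rewrite (LE _ _ _ w0 wi); apply: L0; rewrite -[RHS](uE (lift ord0 ord0)) !mxE unlift_none /=.
  by congr (_ + _); apply: eq_bigr => i _; rewrite !mxE liftK.
have LD a b (z z' : 'rV[R]_n.+1) : L (a *: z + b *: z') = a * L z + b * L z'.
  have e : \sum_i c i * (a *: z + b *: z') ord0 (lift ord0 i) =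
      a * (\sum_i c i * z ord0 (lift ord0 i)) + b * (\sum_i c i * z' ord0 (lift ord0 i)).
    by rewrite !mulr_sumr -big_split; apply: eq_bigr => i _; rewrite !mxE /=; ring.
  by rewrite /L e !mxE; ring.
move=> z; rewrite span_cons span_seq1 => /memv_addP[_ /vlineP[a ->] [_ /vlineP[b ->] ->]].
by apply/eqP; rewrite -subr_eq0 -/(L _) LD Lv Lw !mulr0 addr0.
Qed.

Variables (s t : R).
Hypothesis liminf1 : phi_liminf xi 1 = s%:E.
Hypothesis limsup1 : phi_limsup xi 1 = t%:E.

(* n + t = 1 - t says that the uniform exponent (1 - t) / (n + t) equals 1. The
   minimal points g_i at a geometric sequence of parameters then all lie in one
   plane: nearby triples are dependent by the determinant bound, while g_i and
   g_(i+m) are independent because the ordinary exponent is finite. A rational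
   hyperplane containing this plane contains the direction (1, xi). *)
Lemma uniform_exponent_neq1 : (2 <= n)%N -> Qlin_indep xi -> - n%:R < s <= 0 ->
  n%:R + t != 1 - t.
Proof.
move=> n2 indep /andP[sn s0]; apply/eqP; set N : R := n%:R => Nt.
have N2 : 2 <= N by rewrite ler_nat.
pose c := 1 - t; have c1 : 1 < c by rewrite /c; lra.
pose s1 := (s - N) / 2.
have s1s : s1 < s by rewrite /s1; move: sn; rewrite -/N; lra.
have Ns1 : 0 < N + s1 by rewrite /s1; move: sn; rewrite -/N; lra.
have s11 : 0 < 1 - s1 by rewrite /s1; lra.
(* For large p, a point with tail below e^(-(c - e) K p) has head at least e^(2 (c - e) p) by the
   ordinary exponent, and 2 (c - e) >= c + e. *)
pose K := 1 + 2 * (1 - s1) / (N + s1).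
have K1 : 1 < K by rewrite ltrDl divr_gt0// mulr_gt0.
have KE : 2 * (1 - s1) <= K * (N + s1).
  by rewrite /K [leRHS]mulrDl divfK ?gt_eqF// mul1r; lra.
have K0 : 0 < K by lra.
(* Since x K = 1/4, the parameters below satisfy p i >= 2 x p j whenever j <= i + m. With 3 e = c x,
   the later [eta] equals e (1 - 3 x) > 0. *)
pose x := (4 * K)^-1; have x0 : 0 < x by rewrite invr_gt0; lra.
have xE : x * K = 1 / 4 by rewrite /x; field; lra.
have x14 : x < 1 / 4 by rewrite -xE ltr_pMr.
pose e := c * x / 3.
have e0 : 0 < e by rewrite /e divr_gt0// mulr_gt0//; lra.
have ec : e <= c / 3 by rewrite /e ler_pM2r ?invr_gt0// ler_piMr//; lra.
have [m /andP[mK mK']] := geometric_window x0 (ltW K1).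
have m0 : (0 < m)%N by case: m mK {mK'} => //; rewrite expr0 leNgt K1.
pose ka := 1 + x.
pose t1 := t + e.
have tt1 : t < t1 by rewrite ltrDl.
have [q1 q10 H1] := first_min_lower liminf1 s1s.
have [q3 q30 H3] := first_min_upper limsup1 tt1.
have ct1 : 1 - t1 = c - e by rewrite /t1 /c; lra.
have Nt1 : N + t1 = c + e by rewrite /t1 addrA Nt.
pose eta := (c - e) * (1 + 2 * x) - (c + e) * ka.
have eta0 : 0 < eta.
  rewrite /eta /ka; have eE : 3 * e = c * x by rewrite /e; field.
  have : e * x < e / 4 by rewrite ltr_pM2l//; lra.
  by move: eE; lra.
pose C : R := 1 + \sum_(i < n) `|xi i|.
pose M : R := (n.+1)`!%:R * ((n.+1 - 3)%:R * 1 * C ^+ (n - 3) + 3 * C ^+ (n.+1 - 3)).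
have [Q HQ] := expR_small M eta0.
pose k1 := (c - e) / (1 - s1).
have k10 : 0 < k1 by rewrite divr_gt0//; lra.
pose P := Num.max (Num.max 1 q3) (Num.max Q (q1 / k1)).
have [P1 Pq3 PQ Pq1] : [/\ 1 <= P, q3 <= P, Q <= P & q1 / k1 <= P].
  by rewrite !le_max !lexx !orbT.
pose p i := P * ka ^+ i.
have ka1 : 1 <= ka by rewrite /ka; lra.
have pS i : p i.+1 = ka * p i by rewrite /p exprS mulrCA.
have pP i : P <= p i by rewrite /p ler_peMr ?exprn_ege1//; lra.
have p0 i : 0 < p i by apply: lt_le_trans (pP i); lra.
have pmono i j : (i <= j)%N -> p i <= p j.
  by move=> ij; rewrite /p ler_pM2l ?ler_weXn2l//; lra.
have /choice[g gP] : forall i, exists v, [/\ in_lattice xi v, v != 0,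
    hd v < expR ((c + e) * p i) & tl v < expR (- (c - e) * p i)].
  move=> i; have [v [lv v0 hv tv]] := H3 _ (le_trans Pq3 (pP i)); exists v; split=> //.
    by rewrite -Nt1.
  by rewrite -ct1 opprB.
have ce0 : 0 < c - e by lra.
(* If g i = k g (i + m), then one of the two points, depending on whether |k| <= 1, has both the
   head bound of g i and the tail bound of g (i + m), which the choice of [K] forbids. *)
have indep2 i : free [:: g i; g (i + m)%N].
  have [li gi0 hi ti] := gP i; have [lj gj0 hj tj] := gP (i + m)%N.
  have key v : in_lattice xi v -> v != 0 -> hd v < expR ((c + e) * p i) ->
      ~ tl v < expR (- (c - e) * p (i + m)%N).
    move=> lv v0 hv tv; have qk : q1 <= k1 * p (i + m)%N.
      by rewrite mulrC -ler_pdivrMr//; apply: le_trans Pq1 (pP _).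
    have := H1 _ v qk lv v0; rewrite (_ : (s1 - 1) * _ = - (c - e) * p (i + m)%N).
      move=> /(_ tv) /le_lt_trans/(_ hv); rewrite ltr_expR ltNge => /negP; apply.
      have pim : p i * K <= p (i + m)%N by rewrite /p exprD mulrA ler_pM2l ?p0.
      apply: le_trans (_ : (N + s1) * (k1 * (p i * K)) <= _).
        rewrite (_ : _ * (k1 * _) = (N + s1) * k1 * K * p i); last by ring.
        rewrite ler_pM2r// (_ : _ * K = (K * (N + s1)) * k1); last by ring.
        apply: le_trans (_ : 2 * (1 - s1) * k1 <= _); last by rewrite ler_pM2r.
        rewrite /k1 (_ : _ * (_ / _) = 2 * (c - e)); first by clear - ec; lra.
        by field; rewrite gt_eqF.
      by rewrite !ler_pM2l.
    by rewrite /k1; field; rewrite gt_eqF.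
  apply/negPn/negP => /(free2N gj0)[k kE].
  have [k1'|k1'] := leP `|k| 1.
    apply: (key _ li gi0 hi); apply: le_lt_trans tj; rewrite kE.
    by apply: le_trans (tlZ _ _) _; rewrite ler_piMl// tl_ge0.
  apply: (key _ lj gj0 _ tj); apply: le_lt_trans hi; rewrite kE hdZ.
  by rewrite ler_peMl ?hd_ge0// ltW.
(* Otherwise the three points, completed by vectors of the fixed lattice basis, would have a
   determinant of order at most e^(- eta p_j), hence below 1. *)
have dep3 i j : (i <= j <= i + m)%N -> ~~ free [:: g j.+1; g i; g j].
  move=> /andP[ij jim]; apply/negP => fr.
  have [li _ hi ti] := gP i; have [lj _ hj tj] := gP j; have [lk _ hk tk] := gP j.+1.
  have ls v : v \in [:: g j.+1; g i; g j] -> in_lattice xi v.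
    by rewrite !inE => /or3P[]/eqP->.
  have HW w : w \in [seq row i (lattice_basis xi) | i : 'I_n.+1] ->
      [/\ in_lattice xi w, hd w <= 1 & tl w <= C].
    move=> /mapP[a _ ->]; split; first exact: in_lattice_basis.
      exact: (lattice_basis_bound xi a).1.
    exact: (lattice_basis_bound xi a).2.
  have := lattice_minkowski fr ls (span_row_full (lattice_basis_unit xi)) HW.
  rewrite leNgt => /negP; apply; apply: le_lt_trans (HQ (p j) (le_trans PQ (pP j))).
  rewrite /M -[leRHS]mulrA ler_wpM2l// [leRHS]mulrDl [size _]/=.
  set B := expR (- eta * p j).
  pose X := expR ((c + e) * p j.+1).
  pose Y k := expR (- (c - e) * p k).
  have Yle a b : (a <= b)%N -> Y b <= Y a.
    by move=> ab; rewrite ler_expR !mulNr lerN2 ler_pM2l// pmono.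
  have Y0 k : 0 <= Y k by exact: expR_ge0.
  have X0 : 0 <= X by exact: expR_ge0.
  have hX k : (k <= j.+1)%N -> hd (g k) <= X.
    move=> kj; have [_ _ h _] := gP k; apply/ltW/(lt_le_trans h).
    by rewrite ler_expR ler_pM2l ?pmono// addr_gt0//; lra.
  have tY k a : (a <= k)%N -> tl (g k) <= Y a.
    by move=> ak; have [_ _ _ h] := gP k; apply/ltW/(lt_le_trans h)/Yle.
  have XYB : X * (Y i * Y j) <= B.
    rewrite -!expRD ler_expR pS /eta.
    have pij : 2 * x * p j <= p i.
      apply: le_trans (_ : 2 * x * (p i * ((1 + x) * K)) <= _).
        rewrite ler_pM2l ?mulr_gt0//; apply: le_trans (pmono _ _ jim) _.
        by rewrite /p exprD mulrA ler_pM2l ?p0.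
      rewrite (_ : _ * (p i * _) = p i * (2 * (1 + x) * (x * K))); last by ring.
      by rewrite xE ler_piMr ?(ltW (p0 i))//; clear - x14; lra.
    have : (c - e) * (2 * x * p j) <= (c - e) * p i by rewrite ler_pM2l.
    by clear; lra.
  have X1 : 1 <= X.
    by rewrite -expR0 ler_expR mulr_ge0 ?(ltW (p0 _))//; clear - e0 c1; lra.
  have tk1 : tl (g j.+1) <= 1.
    apply: le_trans (tY _ _ (leqnn _)) _.
    by rewrite -[leRHS]expR0 ler_expR mulNr oppr_le0 mulr_ge0 ?(ltW ce0) ?(ltW (p0 _)).
  have C0 : 0 <= C by rewrite addr_ge0// sumr_ge0.
  have tij := tY _ _ (leqnn i); have tjj := tY _ _ (leqnn j).
  have tki := tY j.+1 i (leqW ij); have tkj := tY j.+1 j (leqW (leqnn j)).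
  rewrite lerD//.
    rewrite ler_wpM2l ?mulr_ge0 ?exprn_ge0//=; apply: le_trans XYB; rewrite mulr1.
    by rewrite ler_pM ?mulr_ge0 ?tl_ge0 ?(le_trans tk1)// ler_pM ?tl_ge0.
  rewrite [leRHS]mulrAC [leRHS]mulrC ler_wpM2l ?exprn_ge0//=.
  rewrite !mulr1 mulr0 addr0 mulrDr.
  have -> : 3 * B = B + (B + B) by ring.
  rewrite lerD ?lerD//; apply: le_trans XYB.
  - by rewrite ler_pM ?mulr_ge0 ?hd_ge0 ?tl_ge0 ?hX// ler_pM ?tl_ge0.
  - rewrite mulrCA ler_pM ?mulr_ge0 ?hd_ge0 ?tl_ge0 ?hX ?(leqW ij)//.
    by rewrite ler_pM ?tl_ge0.
  - rewrite mulrA [leLHS]mulrC ler_pM ?mulr_ge0 ?hd_ge0 ?tl_ge0 ?hX ?(leqW (leqnn j))//.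
    by rewrite [leLHS]mulrC ler_pM ?tl_ge0.
pose U i := (<< [seq g j | j <- iota 0 i.+1] >>)%VS.
have memU i j : (j <= i)%N -> g j \in U i.
  by move=> ji; apply/memv_span/map_f; rewrite mem_iota.
have dimU i : (\dim (U i) <= 2)%N.
  elim: i => [|i ih]; first exact: leq_trans (dim_span _) _.
  (* If a recent g j is independent of g i, then [dep3] puts g (i + 1) in their plane and the span
     does not grow. Otherwise [indep2] forces i < m, all earlier points are multiples of g i, and g
     i, g (i + 1) span everything. *)
  have [[j [ji ijm fij]]|nof] :=
    pselect (exists j, [/\ (j < i)%N, (i <= j + m)%N & free [:: g j; g i]]).
    have : g i.+1 \in << [:: g j; g i] >>%VS.
      have := dep3 j i; rewrite (ltnW ji) ijm free_cons fij /= andbT negbK.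
      exact.
    move=> gi; apply: leq_trans ih; apply: dimvS; apply/span_subvP => v.
    move=> /mapP[k]; rewrite mem_iota /= add0n ltnS leq_eqVlt => /predU1P[->|ki] ->.
      apply: (subvP _ _ gi); apply/span_subvP => u; rewrite !inE => /orP[]/eqP->; apply: memU => //.
      exact: ltnW.
    by apply: memU; rewrite -ltnS.
  have im : (i < m)%N.
    rewrite ltnNge; apply/negP => mi; apply: nof; exists (i - m)%N.
    by rewrite subnK// leqnn -[X in free [:: _; g X]](subnK mi) indep2 ltn_subrL m0 (leq_trans m0 mi).
  apply: leq_trans (dim_span [:: g i; g i.+1]); apply: dimvS; apply/span_subvP => v.
  move=> /mapP[k]; rewrite mem_iota /= add0n ltnS => ki ->.
  move: ki; rewrite leq_eqVlt => /predU1P[->|]; first by apply: memv_span; rewrite !inE eqxx orbT.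
  rewrite ltnS leq_eqVlt => /predU1P[->|ki]; first by apply: memv_span; rewrite !inE eqxx.
  have [_ gi0 _ _] := gP i.
  have [|b ->] := @free2N _ _ (g k) (g i) gi0.
    apply/negP => fki; apply: nof; exists k; split=> //.
    exact: leq_trans (ltnW im) (leq_addl _ _).
  by apply/memvZ/memv_span; rewrite !inE eqxx.
have plane i : g i \in << [:: g 0%N; g m] >>%VS.
  suff -> : (<< [:: g 0%N; g m] >> = U (maxn i m))%VS by rewrite memU// leq_maxl.
  apply/eqP; rewrite eqEdim; apply/andP; split.
    by apply/span_subvP => v; rewrite !inE => /orP[]/eqP->; rewrite memU// leq_maxr.
  by have := indep2 0%N; rewrite /free add0n => /eqP->.
have [l0 _ _ _] := gP 0%N; have [lm _ _ _] := gP m.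
have [c0 [d [cd0 Hcd]]] := rational_annihilator n2 l0 lm.
(* If the linear form in (1, xi) had a nonzero value [th], then hd (g i) |th| would be at most [D]
   times the tail bound of g i, which tends to 0, although hd (g i) >= 1. *)
apply/cd0/indep; apply/eqP; set th := _ + _; rewrite -normr_le0 leNgt; apply/negP => th0.
pose D : R := \sum_i `|ratr (d i)|.
have [Q' HQ'] := expR_small (D / `|th|) ce0.
have [i /andP[Ki _]] : exists i, Num.max 1 Q' <= (1 + x) ^+ i <= (1 + x) * Num.max 1 Q'.
  by apply: geometric_window => //; rewrite le_max lexx.
have [li gi0 _ ti] := gP i.
have Qp : Q' <= p i.
  apply: le_trans (_ : (1 + x) ^+ i <= _); first by apply: le_trans Ki; rewrite le_max lexx orbT.
  by rewrite ler_peMl ?exprn_ge0//; lra.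
have := HQ' _ Qp; rewrite ltNge => /negP; apply.
rewrite mulrAC ler_pdivlMr// mul1r.
have hi1 : 1 <= hd (g i).
  apply: (hd_ge1 li gi0); apply: lt_le_trans ti _.
  by rewrite -[leRHS]expR0 ler_expR mulNr oppr_le0 mulr_ge0 ?(ltW ce0) ?(ltW (p0 _)).
apply: le_trans (_ : hd (g i) * `|th| <= _); first by rewrite ler_peMl.
rewrite /hd -normrM Hcd//; apply: le_trans (ler_norm_sum _ _ _) _.
rewrite /D mulr_suml ler_sum// => k _; rewrite normrM ler_wpM2l//.
exact: le_trans (coord_le_tl _ _) (ltW ti).
Qed.
End Uniform.

(** * The quadratic inequality and the theorem *)

(** If the inequality fails, d and h can be chosen so that all conditions of
    [extremal_contradiction] are strict at the limiting parameters. They then persist for s - e, s +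
    e, t + e and nu + e with small e > 0. *)
Lemma exponents_bound (R : realType) (n : nat) (xi : 'I_n -> R) (s t nu : R) :
  (2 <= n)%N -> phi_liminf xi 1 = s%:E -> phi_limsup xi 1 = t%:E ->
  phi_limsup xi n.+1 = nu%:E -> - n%:R < s <= 0 -> nu < 1 -> - s < n%:R * nu ->
  0 < n%:R + t -> 0 < 1 - t ->
  (1 - t) * (n%:R + s) = (1 + s + (n%:R - 1) * nu) * (n%:R + t) ->
  (1 + s + (n%:R - 1) * nu) ^+ 2 <= (1 - nu) * (1 - s).
Proof.
move=> n2 liminf1 limsup1 limsupn /andP[sn s0] nu1 snu Nt t1 tE.
rewrite leNgt; apply/negP => Q0.
set N : R := n%:R in sn snu Nt tE Q0 *.
have N2 : 2 <= N by rewrite ler_nat.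
pose w := (1 - t) / (N + t).
have Ns : 0 < N + s by lra.
have s1 : 0 < 1 - s by lra.
have Nt0 : N + t != 0 by rewrite gt_eqF.
have s10 : 1 - s != 0 by rewrite gt_eqF.
have w0 : 0 < w by rewrite divr_gt0.
pose B := 1 + s + (N - 1) * nu.
have wB : w * (N + s) = B by rewrite /w mulrAC tE mulfK.
have B0 : 0 < B by rewrite -wB mulr_gt0.
have wE : (1 - w) * (N + s) = (N - 1) * (1 - nu) by rewrite mulrBl wB /B; ring.
have w1 : 0 < 1 - w by rewrite -(pmulr_lgt0 _ Ns) wE mulr_gt0//; lra.
pose Q := B ^+ 2 - (1 - nu) * (1 - s).
have {}Q0 : 0 < Q by rewrite subr_gt0.
(* The bound d < B keeps the threshold exponent d - w a negative; d (1 - s + B) < Q leaves room in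
   the last condition. *)
pose d := Num.min (B / 2) (Q / (2 * (1 - s + B))).
have sB : 0 < 1 - s + B by lra.
have d0 : 0 < d by rewrite lt_min !divr_gt0// mulr_gt0.
have dB : d < B by rewrite /d gt_min; apply/orP; left; lra.
have dQ : d * (1 - s + B) < Q.
  rewrite -ltr_pdivlMr// /d gt_min; apply/orP; right.
  by rewrite invfM mulrA ltr_pM2r ?invr_gt0//; lra.
(* The two entries of the minimum are the margins of the two determinant conditions at h = 1 - nu.
   The factor 2 N ensures that lowering h by [eta] costs less than either. *)
pose eta := Num.min ((1 - w) * d / w) ((Q - d * (1 - s + B)) / (1 - s)) / (2 * N).
have eta0 : 0 < eta.
  rewrite divr_gt0//; last lra.
  rewrite lt_min !divr_gt0// ?mulr_gt0//; lra.
have etaE : 2 * N * eta = Num.min ((1 - w) * d / w) ((Q - d * (1 - s + B)) / (1 - s)).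
  by rewrite /eta mulrC divfK// gt_eqF//; clear - N2; lra.
have eta1 : 2 * N * eta <= (1 - w) * d / w by rewrite etaE ge_min lexx.
have eta2 : 2 * N * eta <= (Q - d * (1 - s + B)) / (1 - s) by rewrite etaE ge_min lexx orbT.
have Ne : 0 < N * eta by rewrite mulr_gt0//; lra.
pose h := 1 - nu - eta.
have idc : e @[e --> (0 : R)^'+] --> (0 : R) by exact: cvg_at_right_filter.
(* The perturbed w, a1 and b1 of [extremal_contradiction], with limits w, N + s and (B - d) (N + s)
   / (1 - s). *)
pose wf e := (1 - (t + e)) / (N + (t + e)).
pose af e := (N + (s - e)) * (1 - (s + e)) / (1 - (s - e)).
pose bf e := (wf e * af e - d) * (N + (s - e)) / (1 - (s - e)).
have cD (c : R) : c + e @[e --> (0 : R)^'+] --> c.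
  by rewrite -{2}[c]addr0; apply: cvgD idc; exact: cvg_cst.
have cB (c : R) : c - e @[e --> (0 : R)^'+] --> c.
  by rewrite -{2}[c]subr0; apply: cvgB idc; exact: cvg_cst.
have cDc (f : R -> R) (c l : R) : f e @[e --> (0 : R)^'+] --> l ->
    c + f e @[e --> (0 : R)^'+] --> c + l by move=> fl; apply: cvgD fl; exact: cvg_cst.
have cBc (f : R -> R) (c l : R) : f e @[e --> (0 : R)^'+] --> l ->
    c - f e @[e --> (0 : R)^'+] --> c - l by move=> fl; apply: cvgB fl; exact: cvg_cst.
have cwf : wf e @[e --> (0 : R)^'+] --> w.
  by apply: cvgM; [exact/cBc/cD|apply: cvgV => //; exact/cDc/cD].
have caf : af e @[e --> (0 : R)^'+] --> N + s.
  rewrite -[N + s](mulfK s10); apply: cvgM; first by apply: cvgM; [exact/cDc/cB|exact/cBc/cD].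
  by apply: cvgV => //; exact/cBc/cB.
have cbf : bf e @[e --> (0 : R)^'+] --> (B - d) * (N + s) / (1 - s).
  apply: cvgM; last by apply: cvgV => //; exact/cBc/cB.
  apply: cvgM; last exact/cDc/cB.
  by apply: cvgB; [rewrite -wB; exact: cvgM|exact: cvg_cst].
have pos (f : R -> R) (l : R) : f e @[e --> (0 : R)^'+] --> l -> 0 < l ->
    \forall e \near (0 : R)^'+, 0 < f e by move=> fl l0; exact: cvgr_gt fl _ l0.
have p1 := pos _ _ (cBc _ 1 _ (cD s)) s1.
have p2 := pos _ _ (cDc _ N _ (cB s)) Ns.
have p3 := pos _ _ (cDc _ N _ (cD t)) Nt.
have p4 := pos _ _ (cBc _ 1 _ (cD t)) t1.
have p5 := pos _ _ (cBc _ 1 _ cwf) w1.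
have p6 : \forall e \near (0 : R)^'+, 0 < wf e * af e - d.
  apply: (pos _ (w * (N + s) - d)); first by apply: cvgB; [exact: cvgM|exact: cvg_cst].
  by rewrite wB subr_gt0.
have p7 : \forall e \near (0 : R)^'+, 0 < 1 - (nu + e) - h.
  apply: (pos _ (1 - nu - h)); first by apply: cvgB; [exact/cBc/cD|exact: cvg_cst].
  by rewrite /h; lra.
have p8 : \forall e \near (0 : R)^'+, 0 < 1 - (s + e) - h.
  apply: (pos _ (1 - s - h)); first by apply: cvgB; [exact/cBc/cD|exact: cvg_cst].
  have nu0 : 0 <= nu by rewrite -(pmulr_rge0 (x := N)); lra.
  by rewrite /h; lra.
have p9 : \forall e \near (0 : R)^'+, 0 < af e + 1 - (s + e) - N - (nu + e) - h.
  apply: (pos _ (N + s + 1 - s - N - nu - h)); last by rewrite /h; lra.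
  apply: cvgB; last exact: cvg_cst.
  apply: cvgB => //; apply: cvgB; last exact: cvg_cst.
  by apply: cvgB => //; apply: cvgD => //; exact: cvg_cst.
have p10 : \forall e \near (0 : R)^'+,
    0 < (N - 1) * h - (1 - wf e) * (N + (s + e) - d / wf e).
  apply: (pos _ ((N - 1) * h - (1 - w) * (N + s - d / w))).
    apply: (cBc); apply: cvgM; first exact: (cBc _ 1 _ cwf).
    apply: cvgB; first exact/cDc/cD.
    by apply: cvgM; [exact: cvg_cst|apply: cvgV => //; rewrite gt_eqF].
  have -> : (1 - w) * (N + s - d / w) = (1 - w) * (N + s) - (1 - w) * d / w.
    by rewrite mulrBr mulrA.
  rewrite wE /h.
  by move: eta1 Ne eta0; lra.
have p11 : \forall e \near (0 : R)^'+,
    0 < (N - 2) * h - ((1 - wf e) * (N + (s + e)) + d - wf e * bf e).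
  apply: (pos _ ((N - 2) * h - ((1 - w) * (N + s) + d - w * ((B - d) * (N + s) / (1 - s))))).
    apply: (cBc); apply: cvgB; last exact: cvgM.
    by apply: cvgD; [apply: cvgM; [exact: (cBc _ 1 _ cwf)|exact/cDc/cD]|exact: cvg_cst].
  have -> : w * ((B - d) * (N + s) / (1 - s)) = (B - d) * B / (1 - s).
    by rewrite -[in RHS]wB -wB; field.
  rewrite wE /h; have -> : (N - 2) * (1 - nu - eta) - ((N - 1) * (1 - nu) + d - (B - d) * B / (1 - s))
    = (Q - d * (1 - s + B)) / (1 - s) - (N - 2) * eta by rewrite /Q; field.
  by move: eta2 Ne eta0; lra.
have [e] : exists e, [/\ 0 < e, 0 < 1 - (s + e), 0 < N + (s - e), 0 < N + (t + e) & 0 < 1 - (t + e)] /\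
    [/\ 0 < 1 - wf e, 0 < wf e * af e - d, 0 < 1 - (nu + e) - h & 0 < 1 - (s + e) - h] /\
    [/\ 0 < af e + 1 - (s + e) - N - (nu + e) - h,
     0 < (N - 1) * h - (1 - wf e) * (N + (s + e) - d / wf e)
     & 0 < (N - 2) * h - ((1 - wf e) * (N + (s + e)) + d - wf e * bf e)].
  apply: (@filter_ex _ (0 : R)^'+); near=> e.
  split; [split|split; split]; try by near: e.
  by near: e; exact: nbhs_right_gt.
case=> [[e0 r1 r2 r3 r4] [[r5 r6 r7 r8] [r9 r10 r11]]].
apply: (@extremal_contradiction R n xi s t nu (s - e) (s + e) (t + e) (nu + e) d h n2
  liminf1 limsup1 limsupn) => //; rewrite -/N -/(wf e) -/(af e) -/(bf e) -1?subr_gt0//;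
  clear - e0 r1 r2 r3 r4 r5 r6 r7 r8 r9 r10 r11; lra.
Unshelve. all: by end_near.
Qed.

Theorem theorem6p3 (R : realType) (n : nat) (s nu : R) :
  (2 <= n)%N ->
  - n%:R <= s <= 0 ->
  let nu0 := ((3 - 2 * n%:R) * s + 1 - 2 * n%:R
              + Num.sqrt ((1 - s) * ((4 * n%:R - 5) * s + 4 * n%:R ^+ 2 - 4 * n%:R + 1)))
             / (2 * (n%:R - 1) ^+ 2) in
  ~ (- s / n%:R <= nu <= nu0) ->
  ~ (exists xi : 'I_n -> R,
       Qlin_indep xi /\
       phi_liminf xi 1 = s%:E /\
       phi_limsup xi n.+1 = nu%:E /\
       exists phibar1 : R,
         phi_limsup xi 1 = phibar1%:E /\
         n%:R * nu + s
           = - phibar1 * ((n%:R + 1) / (n%:R - 1) + nu + 2 / (n%:R - 1) * s)).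
Proof.
move=> n2 /andP[sn s0] nu0 out [xi [indep [liminf1 [limsupn [t [limsup1 eqt]]]]]].
apply: out; have nuge := last_min_ge n2 liminf1 limsupn; rewrite nuge /=.
have nu1 := last_min_le1 limsupn.
(* Up to the factor 4 (n - 1)^2, this is the quadratic inequality whose larger root is nu0. *)
have bound : (1 + s + (n%:R - 1) * nu) ^+ 2 <= (1 - nu) * (1 - s).
  have N2 : 2 <= n%:R :> R by rewrite ler_nat.
  have N0 : 0 < n%:R :> R by lra.
  (* At the endpoint n nu = - s the inequality reads (1 - nu)^2 <= (1 - nu) (1 + n nu) and holds
     directly. *)
  move: nuge; rewrite ler_pdivrMr// mulrC le_eqVlt => /predU1P[sE|snu].
    have nu_ge0 : 0 <= nu by rewrite -(pmulr_rge0 _ N0) -sE; lra.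
    have -> : s = - (n%:R * nu) by rewrite -sE opprK.
    rewrite (_ : 1 + _ + _ = 1 - nu); last by ring.
    rewrite expr2 opprK ler_wpM2l ?subr_ge0//.
    by have : 0 <= n%:R * nu by [rewrite mulr_ge0// ltW]; lra.
  have nuN : n%:R * nu <= n%:R by rewrite ler_piMr// ltW.
  have sn' : - n%:R < s by lra.
  (* This is n - 1 times the bracket in the equality case. From n nu >= - s follows n den >= (n + 1)
     (n + s) > 0. *)
  pose den := n%:R + 1 + (n%:R - 1) * nu + 2 * s.
  have tden : t * den = - ((n%:R - 1) * (n%:R * nu + s)).
    by rewrite eqt /den; field; lra.
  have Nsnu : (n%:R - 1) * - s <= (n%:R - 1) * (n%:R * nu).
    by rewrite ler_wpM2l ?ltW//; lra.
  have den0 : 0 < den.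
    rewrite -(pmulr_rgt0 _ N0); apply: lt_le_trans (_ : (n%:R + 1) * (n%:R + s) <= _).
      by rewrite mulr_gt0//; lra.
    by rewrite /den; lra.
  have num0 : 0 < 1 + s + (n%:R - 1) * nu.
    rewrite -(pmulr_rgt0 _ N0); apply: lt_le_trans (_ : n%:R + s <= _); first lra.
    by lra.
  have Nt : den * (n%:R + t) = (n%:R + 1) * (n%:R + s).
    by rewrite mulrDr [den * t]mulrC tden /den; ring.
  have t1 : den * (1 - t) = (n%:R + 1) * (1 + s + (n%:R - 1) * nu).
    by rewrite mulrBr [den * t]mulrC tden /den; ring.
  have tE : (1 - t) * (n%:R + s) = (1 + s + (n%:R - 1) * nu) * (n%:R + t).
    by apply: (mulfI (lt0r_neq0 den0)); rewrite mulrA t1 mulrCA Nt; ring.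
  (* For nu = 1, [tE] reduces to 1 - t = n + t, which [uniform_exponent_neq1] excludes. *)
  move: nu1; rewrite le_eqVlt => /predU1P[nuE|nu1].
    have : n%:R + t != 1 - t.
      by apply: (uniform_exponent_neq1 liminf1 limsup1 n2 indep); rewrite sn' s0.
    have Ns : n%:R + s != 0 by rewrite gt_eqF//; lra.
    case/eqP; apply: (mulIf Ns); rewrite tE nuE; ring.
  apply: (exponents_bound n2 liminf1 limsup1 limsupn) => //.
  - by rewrite sn' s0.
  - by rewrite -(pmulr_rgt0 _ den0) Nt mulr_gt0//; lra.
  - by rewrite -(pmulr_rgt0 _ den0) t1 mulr_gt0//; lra.
have N1 : 0 < n%:R - 1 :> R by rewrite subr_gt0 ltr1n.
rewrite ler_pdivlMr ?mulr_gt0 ?exprn_gt0//.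
(* After clearing the denominator, nu <= nu0 says that y is at most the square root, which follows
   once y^2 is at most the radicand. *)
pose y := nu * (2 * (n%:R - 1) ^+ 2) - ((3 - 2 * n%:R) * s + 1 - 2 * n%:R).
rewrite -lerBlDl -/y; apply: le_trans (ler_norm y) _; rewrite -sqrtr_sqr.
apply: ler_wsqrtr; rewrite -subr_ge0.
rewrite (_ : _ - _ = 4 * (n%:R - 1) ^+ 2 *
    ((1 - nu) * (1 - s) - (1 + s + (n%:R - 1) * nu) ^+ 2)); last by rewrite /y; ring.
by rewrite mulr_ge0 ?subr_ge0// mulr_ge0// exprn_ge0// ltW.
Qed.
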